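(* Let $T,M>0$, let $A(p,t)=[a^{ij}(p,t)]$ be a symmetric, positive semi-definite $n\times n$ matrix depending smoothly on $(p,t)\in\mathbb{R}^n\times[0,T]$, and let $b:\mathbb{R}^n\times[0,T]\to\mathbb{R}$. Let $u:\mathbb{R}^n\times[0,T]\to\mathbb{R}$ be a smooth solution of $$\frac{\partial u}{\partial t}=a^{ij}(Du,t)D_{ij}u+b(Du,t),\qquad u(x,0)=u_0(x),$$ where $u_0$ is smooth with $\operatorname{osc}u_0\le M$ and $u$ is spatially periodic with respect to some lattice $\Gamma$ of $\mathbb{R}^n$, as is $u_0$ ($u_0(x)=u_0(x+\Gamma)$). Suppose that $\alpha(p,t)=\tilde\alpha(|p|)>0$ for all $p$, where $\alpha$ is the function defined in the context. If $\varphi:\mathbb{R}^+\times[0,T]\to\mathbb{R}$ is a smooth solution of the one-dimensional equation $$\varphi_t=4\tilde\alpha(|\varphi'|)\varphi''$$ satisfying $\lim_{t\to0}\varphi(z,t)=1$ for $z\ne0$, $\varphi(0,t)=0$ for all $t>0$, and $\lim_{z\to\infty}\varphi(z,t)=1$ for all $t>0$, then $$|u(y,t)-u(x,t)|\le M\varphi\!\left(\frac{|y-x|}{M},\frac{t}{M^2}\right)$$ for all $x,y\in\mathbb{R}^n$ and all $t\in(0,T]$ with $t/M^2\le T$.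
   Context: Repeated indices are summed; $\operatorname{osc}f=\sup f-\inf f$; $'$ denotes the derivative of $\varphi$ in its first (space) variable. For the matrix $A(p,t)$ define $$\alpha(p,t):=|p|^2\inf_{v\in S^{n-1},\ v\cdot p\neq0}\frac{v^TA(p,t)v}{(v\cdot p)^2}.$$ The hypothesis $\alpha(p,t)=\tilde\alpha(|p|)$ means that $\alpha$ depends only on $|p|$, through the function $\tilde\alpha$; at $p=0$, where the formula is not meaningful, $\tilde\alpha(0)>0$ is understood as the continuous extension of $\tilde\alpha$.
   Formalization: φ is assumed non-negative at the arguments occurring in the conclusion (the conclusion forces this; without it a solution singular at the corner is a counterexample), and φ is smooth away from (0,0), since its boundary and initial values are incompatible there. *)

(* Defs.v *)
From HB Require Import structures.
From mathcomp Require Import all_boot all_order all_algebra.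
From mathcomp Require Import all_classical all_reals all_analysis.

Set Implicit Arguments.
Unset Strict Implicit.
Unset Printing Implicit Defensive.

Import Order.TTheory GRing.Theory Num.Theory.
Import numFieldNormedType.Exports.

Local Open Scope classical_set_scope.
Local Open Scope ring_scope.

(* The norm `| _ | that the library puts on 'rV_n is the sup norm. *)
Definition dot (R : realType) (n : nat) (x y : 'rV[R]_n) : R :=
  \sum_(i < n) x 0 i * y 0 i.

Definition enorm (R : realType) (n : nat) (x : 'rV[R]_n) : R :=
  Num.sqrt (dot x x).

(* In finite dimension, f is C^k on the open set U if and only if all its
   iterated directional derivatives up to order k exist and are continuous
   on U. *)
Fixpoint Ck_on (R : realType) (V : normedModType R) (k : nat)
    (U : set V) (f : V -> R) : Prop :=
  (forall x, U x -> {for x, continuous f}) /\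
  (if k is k'.+1 then
     forall v : V, (forall x, U x -> derivable f x v) /\ Ck_on k' U ('D_v f)
   else True).

(* Smoothness on a set D that need not be open (such as R^n x [0, T]): f is
   the restriction to D of a C^oo function on an open neighbourhood of D. *)
Definition smooth_on (R : realType) (V : normedModType R)
    (D : set V) (f : V -> R) : Prop :=
  exists (U : set V) (g : V -> R),
    [/\ open U, D `<=` U, (forall k : nat, Ck_on k U g)
      & forall x, D x -> f x = g x].

Definition partial (R : realType) (n : nat) (i : 'I_n) (f : 'rV[R]_n -> R)
    (x : 'rV[R]_n) : R :=
  'D_(delta_mx 0 i) f x.

Definition gradient (R : realType) (n : nat) (f : 'rV[R]_n -> R)
    (x : 'rV[R]_n) : 'rV[R]_n :=
  \row_i partial i f x.

Definition psd (R : realType) (n : nat) (A : 'M[R]_n) : Prop :=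
  forall v : 'rV[R]_n, 0 <= dot (v *m A) v.

(* Meaningful for p != 0 only; for p = 0 the infimum is over the empty set. *)
Definition alpha (R : realType) (n : nat) (A : 'M[R]_n) (p : 'rV[R]_n) : R :=
  enorm p ^+ 2 *
  inf [set dot (v *m A) v / dot v p ^+ 2
      | v in [set v : 'rV[R]_n | enorm v = 1 /\ dot v p != 0]].

(* A lattice of R^n is of full rank: the integer span of a basis of R^n, here
   given by the rows of B. *)
Definition is_lattice (R : realType) (n : nat) (G : set 'rV[R]_n) : Prop :=
  exists2 B : 'M[R]_n, B \in unitmx &
    G = [set map_mx (fun k : int => k%:~R) z *m B | z in [set: 'rV[int]_n]].

(* Extended-real valued, so that no boundedness is presupposed. *)
Definition osc (R : realType) (X : Type) (f : X -> R) : \bar R :=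
  (ereal_sup (range (EFin \o f)) - ereal_inf (range (EFin \o f)))%E.

(* Main.v *)
(* Two-point maximum principle. Put psi(z, t) = M phi(z / M, t / M^2) and
   Z(x, d, t) = u(x + d, t) - u(x, t) - psi(|d|, t) - eps (1 + t), and suppose
   that Z is somewhere nonnegative. Near d = 0 and at t = 0, Z is negative because
   psi >= 0 and psi(z, 0) = M; for |d| large it is negative because the oscillation
   of u stays at most M while psi(z, t) tends to M uniformly in t, by comparison
   with a wide parabola. Periodicity in x then yields a global maximum with
   t > 0 and d <> 0. There Du(x) = Du(x + d) = psi' e with e = d / |d|; translating
   both points shows that N = D^2 u(x + d) - D^2 u(x) is negative semi-definite, and
   moving them apart along e gives e N e^T <= 4 psi''. As A - alphat(|psi'|) e^T e is
   positive semi-definite, tr(A N) <= 4 alphat(|psi'|) psi'' = psi_t, so the time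
   derivative of Z is at most -eps, contradicting maximality. *)

Require Import Defs.
From HB Require Import structures.
From mathcomp Require Import all_boot all_order all_algebra.
From mathcomp Require Import all_classical all_reals all_analysis.
From mathcomp Require Import ring lra.

Set Implicit Arguments.
Unset Strict Implicit.
Unset Printing Implicit Defensive.

Import Order.TTheory GRing.Theory Num.Theory.
Import numFieldNormedType.Exports.

Local Open Scope classical_set_scope.
Local Open Scope ring_scope.

(** * Derivatives on the line and along directions *)

Lemma is_derive_cvg (R : numFieldType) (V : normedModType R) (f : V -> R)
    (x v : V) (d : R) : is_derive x v f d ->
  h^-1 * (f (h *: v + x) - f x) @[h --> 0^'] --> d.
Proof. by move=> [] /[swap] <-. Qed.

Lemma cvg_is_derive (R : numFieldType) (V : normedModType R) (f : V -> R)
    (x v : V) (d : R) :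
  h^-1 * (f (h *: v + x) - f x) @[h --> 0^'] --> d -> is_derive x v f d.
Proof.
move=> fd; split; first by apply: (cvgP d); exact: fd.
by apply/cvg_lim => //; exact: fd.
Qed.

(** Difference quotients from the left are nonnegative. The one-sided form fits a maximum reached at
    the last time considered. *)
Lemma left_max_derive_ge0 (R : realType) (f : R -> R) (a b d : R) :
  a < b -> is_derive b 1 f d -> (forall s, a < s <= b -> f s <= f b) -> 0 <= d.
Proof.
move=> ab /is_derive_cvg /cvg_dnbhs_at_left fd fmax.
rewrite -(cvg_lim _ fd)//; apply: limr_ge; first by apply/cvg_ex; exists d.
near=> h; apply: mulr_le0; first by rewrite invr_le0 ltW.
rewrite subr_le0 fmax// scaler1 -ltrBlDr; apply/andP; split.
  by near: h; apply: nbhs_left_gt; rewrite subr_lt0.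
by rewrite gerDr.
Unshelve. all: by end_near. Qed.

(** If [c > 0], then [g1] is positive just to the right of [a], and the mean value theorem makes [g]
    exceed [g a] there. *)
Lemma second_derivative_test (R : realType) (g g1 : R -> R) (a c : R) :
  (\forall s \near a, is_derive (s : R) 1 g (g1 s)) -> is_derive a 1 g1 c ->
  (\forall s \near a, g s <= g a) -> g1 a = 0 /\ c <= 0.
Proof.
move=> dg dg1 gmax.
have /nbhs_ballP[r /= r0 rP] : \forall s \near a,
    is_derive (s : R) 1 g (g1 s) /\ g s <= g a by apply: filterI.
have inB s : s \in `]a - r, a + r[ -> ball a r s.
  by rewrite in_itv /= /ball /= ltr_distlC.
have Ba : ball a r a by exact: ballxx.
have g1a : g1 a = 0.
  have d0 : is_derive a 1 g 0.
    apply: (@derive1_at_max _ g (a - r) (a + r)).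
    - by rewrite lerD2l ge0_cp// ltW.
    - by move=> t /inB /rP[[]].
    - by rewrite in_itv /= ltrBlDr !ltrDl r0.
    - by move=> t /inB /rP[].
  by have [[_ <-] _] := rP _ Ba; case: d0.
split=> //; rewrite leNgt; apply/negP => c0.
have /is_derive_cvg /cvg_dnbhs_at_right := dg1.
rewrite g1a => /cvgr_gt /(_ _ c0) [r' /= r'0 r'P].
pose e := Num.min r r' / 2.
have e0 : 0 < e by rewrite divr_gt0// lt_min r0 r'0.
have er : e < r.
  by rewrite /e ltr_pdivrMr// mulr_natr mulr2n; case: (ltP r r') => ?; lra.
have er' : e < r'.
  by rewrite /e ltr_pdivrMr// mulr_natr mulr2n; case: (ltP r r') => ?; lra.
have ae : a < a + e by rewrite ltrDl.
have [|| xi xiP E] := @MVT _ g g1 a (a + e) ae.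
- move=> s; rewrite in_itv /= => /andP[s1 s2].
  by apply: (rP s _).1; apply: inB; rewrite in_itv /=; apply/andP; split; lra.
- apply: derivable_within_continuous => s; rewrite in_itv /= => /andP[s1 s2].
  suff /rP[[]] : ball a r s by [].
  by apply: inB; rewrite in_itv /=; apply/andP; split; lra.
have ga : g (a + e) <= g a.
  by apply: (rP _ _).2; apply: inB; rewrite in_itv /=; apply/andP; split; lra.
move: xiP; rewrite in_itv /= => /andP[xi1 xi2].
have xia : 0 < xi - a by lra.
have : 0 < (xi - a)^-1 * (g1 ((xi - a)%:A + a) - 0).
  by apply: r'P => //=; rewrite sub0r normrN gtr0_norm//; lra.
rewrite scaler1 subrK subr0 pmulr_rgt0 ?invr_gt0// => g1xi.
have : 0 < g1 xi * (a + e - a) by rewrite mulr_gt0//; lra.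
lra.
Qed.

Lemma is_derive_lineP (R : realType) (V : normedModType R) (f : V -> R)
    (x v : V) (s d : R) :
  is_derive s 1 (fun s => f (x + s *: v)) d <-> is_derive (x + s *: v) v f d.
Proof.
have E : (fun h => h^-1 * (f (h *: v + (x + s *: v)) - f (x + s *: v))) =
         (fun h => h^-1 * (f (x + (h *: 1 + s) *: v) - f (x + s *: v))).
  by apply/funext => h; rewrite scaler1 scalerDl addrCA.
split=> /is_derive_cvg fd; apply: cvg_is_derive.
  by rewrite E.
by move: fd; rewrite E.
Qed.

Lemma MVT0 (R : realType) (k k1 : R -> R) (h : R) :
  (forall s : R, is_derive s 1 k (k1 s)) ->
  exists2 c, `|c| <= `|h| & k h - k 0 = h * k1 c.
Proof.
move=> dk.
have ck (i : interval R) : {within [set` i], continuous k}.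
  by apply: derivable_within_continuous => s _; case: (dk s).
have [h0|h0] := leP 0 h.
  have [|c] := @MVT_segment _ k k1 0 h h0.
    exact: ck.
  rewrite in_itv /= subr0 => /andP[c0 ch] ->; exists c; last by rewrite mulrC.
  by rewrite !ger0_norm.
have [|c] := @MVT_segment _ k k1 h 0 (ltW h0).
  exact: ck.
rewrite in_itv /= sub0r => /andP[ch c0] E; exists c.
  by rewrite !ler0_norm ?lerN2// ltW.
by rewrite -opprB E mulrN opprK mulrC.
Qed.

(** The increment along [v + w] is one along [v] followed by one along [w]; the mean value theorem
    turns the latter into [h] times ['D_w f] at a point tending to [x], where continuity applies. *)
Lemma is_derive_dirD (R : realType) (V : normedModType R) (f : V -> R)
    (x v w : V) :
  derivable f x v -> (forall y, derivable f y w) ->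
  {for x, continuous ('D_w f)} ->
  is_derive x (v + w) f ('D_v f x + 'D_w f x).
Proof.
move=> fv fw cw; apply: cvg_is_derive.
have fvx : is_derive x v f ('D_v f x) by exact: derivableP.
have /choice[th thP] : forall h, exists c, `|c| <= `|h| /\
    f (h *: w + (h *: v + x)) - f (h *: v + x) =
    h * 'D_w f ((h *: v + x) + c *: w).
  move=> h; have [|c ch E] := @MVT0 _ (fun s => f ((h *: v + x) + s *: w))
      (fun s => 'D_w f ((h *: v + x) + s *: w)) h.
    by move=> s; apply/is_derive_lineP; exact: derivableP.
  by exists c; split=> //; rewrite -E scale0r addr0 [h *: w + _]addrC.
have lim2 : 'D_w f ((h *: v + x) + th h *: w) @[h --> 0^'] --> 'D_w f x.
  apply/cvgrPdist_lt => e e0.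
  have /cvgrPdist_lt/(_ _ e0)/nbhs_ballP[r /= r0 rP] := cw.
  pose C := `|v| + `|w| + 1.
  have C0 : 0 < C by rewrite ltr_wpDl// addr_ge0.
  near=> h; apply: rP.
  rewrite -ball_normE /= -addrA addrCA opprD addNKr normrN.
  apply: (@le_lt_trans _ _ (`|h| * C)).
    rewrite (le_trans (ler_normD _ _))// !normrZ !mulrDr mulr1.
    have := ler_wpM2r (normr_ge0 w) (thP h).1.
    have := normr_ge0 h; lra.
  rewrite -ltr_pdivlMr//; near: h; apply: dnbhs0_lt; exact: divr_gt0.
apply: (cvg_trans _ (cvgD (is_derive_cvg fvx) lim2)).
apply: near_eq_cvg; near=> h.
have h0 : h != 0 by near: h; exact: nbhs_dnbhs_neq.
have [_ E] := thP h.
rewrite /= scalerDr [h *: v + h *: w]addrC -addrA.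
rewrite -[f (_ + _) - f x](subrKA (f (h *: v + x))) E.
by rewrite mulrDr [h^-1 * (h * _)]mulKf// addrC.
Unshelve. all: by end_near. Qed.

Lemma max_derive_eq0 (R : realType) (g : R -> R) (c : R) :
  is_derive (0 : R) 1 g c -> (forall s, g s <= g 0) -> c = 0.
Proof.
move=> dg gmax; have N10 : (-1 : R) < 0 by rewrite oppr_lt0.
have dgN : is_derive (0 : R) 1 (g \o -%R) (c * -1).
  have dN : is_derive (0 : R) 1 -%R (-1) by exact: is_deriveNid.
  by apply: is_derive1_comp dN; rewrite oppr0.
have c1 := left_max_derive_ge0 N10 dg (fun s _ => gmax s).
have := @left_max_derive_ge0 _ _ (-1) 0 _ N10 dgN.
rewrite /= oppr0 => /(_ (fun s _ => gmax (- s))) c2; lra.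
Qed.

Lemma is_derive_dirZ (R : realType) (V : normedModType R) (f : V -> R)
    (x v : V) (a d : R) :
  is_derive x v f d -> is_derive x (a *: v) f (a * d).
Proof.
move=> fd; rewrite -[x]addr0 -[0](scale0r (a *: v)); apply/is_derive_lineP.
have fd0 : is_derive (a * 0) 1 (fun s => f (x + s *: v)) d.
  by apply/is_derive_lineP; rewrite mulr0 scale0r addr0.
have da : is_derive (0 : R) 1 (fun s : R => a * s) a.
  by apply: is_derive_eq; rewrite [a%:A]mulr1.
have := is_derive1_comp fd0 da; rewrite mulrC.
by congr is_derive; apply/funext => s /=; rewrite scalerA mulrC.
Qed.

(** Additivity in the direction is applied along the expansion of [v] in the standard basis, one
    coordinate at a time. *)
Lemma derive_sum_partial (R : realType) (n : nat) (f : 'rV[R]_n -> R) (v x : 'rV[R]_n) :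
  (forall y w, derivable f y w) -> (forall w, continuous ('D_w f)) ->
  'D_v f x = \sum_i v 0 i * partial i f x.
Proof.
move=> df cf.
suff D (s : seq 'I_n) : is_derive x (\sum_(i <- s) v 0 i *: delta_mx 0 i) f
    (\sum_(i <- s) v 0 i * partial i f x).
  by rewrite {1}(row_sum_delta v); apply: derive_val; exact: D.
elim: s => [|i s IH]; first by rewrite !big_nil; exact: is_derive0.
rewrite !big_cons.
have dZ := is_derive_dirZ (v 0 i) (derivableP (df x (delta_mx 0 i))).
case: dZ => dZ1 dZ2; case: IH => IH1 IH2; rewrite /partial -dZ2 -IH2.
by apply: is_derive_dirD; [exact: dZ1 | move=> y; exact: df | exact: cf].
Qed.

(** * Directional derivatives of C^2 functions in coordinates *)

Section directional.
Variables (R : realType) (n : nat) (f : 'rV[R]_n -> R).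
Hypothesis Cf : Ck_on 2 setT f.

Lemma Ck2_derivable x v : derivable f x v.
Proof. by case: Cf => _ /(_ v)[+ _]; exact. Qed.

Lemma Ck2_derive_continuous v : continuous ('D_v f).
Proof. by case: Cf => _ /(_ v)[_ [+ _]] x; exact. Qed.

Lemma Ck2_derive2_derivable v w x : derivable ('D_v f) x w.
Proof. by case: Cf => _ /(_ v)[_ [_ /(_ w)[+ _]]]; exact. Qed.

Lemma Ck2_derive2_continuous v w : continuous ('D_w ('D_v f)).
Proof. by case: Cf => _ /(_ v)[_ [_ /(_ w)[_ [+ _]]]] x; exact. Qed.

Lemma Ck2_dirE v x : 'D_v f x = \sum_i v 0 i * partial i f x.
Proof.
apply: derive_sum_partial; first by move=> ? ?; exact: Ck2_derivable.
exact: Ck2_derive_continuous.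
Qed.

Lemma Ck2_dir2E v x : 'D_v ('D_v f) x =
  \sum_i \sum_j v 0 i * v 0 j * partial i (partial j f) x.
Proof.
rewrite derive_sum_partial; last 2 first.
- by move=> y w; exact: Ck2_derive2_derivable.
- by move=> w; exact: Ck2_derive2_continuous.
apply: eq_bigr => i _; rewrite {1}/partial.
have -> : 'D_v f = \sum_j (v 0 j \*: partial j f).
  by apply/funext => y; rewrite Ck2_dirE fct_sumE.
rewrite derive_sum; last first.
  by move=> j; apply: derivableZ; exact: Ck2_derive2_derivable.
rewrite mulr_sumr; apply: eq_bigr => j _.
by rewrite deriveZ ?mulrA//; exact: Ck2_derive2_derivable.
Qed.

End directional.

(** Openness makes the two functions agree near each point of [U], so their derivatives agree on [U]
    and the induction continues. *)
Lemma eq_Ck_on (R : realType) (V : normedModType R) (k : nat) (U : set V)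
    (f g : V -> R) : open U -> (forall x, U x -> f x = g x) ->
  Ck_on k U f -> Ck_on k U g.
Proof.
move=> oU; elim: k f g => [|k IH] f g fg.
all: have nfg x : U x -> \forall y \near x, f y = g y by
  move=> Ux; near=> y; apply: fg; near: y; exact: open_nbhs_nbhs.
all: have cg : (forall x, U x -> {for x, continuous f}) ->
    forall x, U x -> {for x, continuous g} by
  move=> cf x Ux; rewrite /prop_for /continuous_at -(fg _ Ux);
  apply: cvg_trans (cf _ Ux); apply: near_eq_cvg; exact: nfg.
  by move=> [cf _]; split=> //; exact: cg.
move=> [cf Cf]; split; first exact: cg.
move=> v; have [df Cdf] := Cf v; split.
  by move=> x Ux; apply: (near_eq_derivable (nfg _ Ux)); exact: df.
by apply: IH Cdf => x Ux; apply: near_eq_derive; exact: nfg.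
Unshelve. all: by end_near. Qed.

(** * Slices of functions on a product *)

Section slices.
Variables (R : realType) (V W : normedModType R) (g : V * W -> R).

Lemma derive_slice_left (t : W) (x v : V) :
  (derivable g (x, t) (v, 0) -> derivable (fun y => g (y, t)) x v) *
  ('D_v (fun y => g (y, t)) x = 'D_(v, 0) g (x, t)).
Proof.
have E : (fun h : R => h^-1 *: (((fun y => g (y, t)) \o shift x) (h *: v) - g (x, t)))
  = (fun h => h^-1 *: ((g \o shift (x, t)) (h *: (v, 0)) - g (x, t))).
  apply/funext => h /=; congr (_ *: (g _ - _)).
  by apply: injective_projections => //=; rewrite scaler0 add0r.
by split; rewrite /derivable /derive E.
Qed.

Lemma derive_slice_right (x : V) (t v : W) :
  (derivable g (x, t) (0, v) -> derivable (fun s => g (x, s)) t v) *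
  ('D_v (fun s => g (x, s)) t = 'D_(0, v) g (x, t)).
Proof.
have E : (fun h : R => h^-1 *: (((fun s => g (x, s)) \o shift t) (h *: v) - g (x, t)))
  = (fun h => h^-1 *: ((g \o shift (x, t)) (h *: (0, v)) - g (x, t))).
  apply/funext => h /=; congr (_ *: (g _ - _)).
  by apply: injective_projections => //=; rewrite scaler0 add0r.
by split; rewrite /derivable /derive E.
Qed.

End slices.

Lemma continuous_slice_left (R : realType) (V W : normedModType R)
    (g : V * W -> R) (t : W) (x : V) :
  {for (x, t), continuous g} -> {for x, continuous (fun y => g (y, t))}.
Proof.
move=> cg; apply: (@continuous_comp _ _ _ (fun y => (y, t)) g) => //.
by apply: cvg_pair => //; exact: cvg_cst.
Qed.

Lemma Ck_on_slice (R : realType) (V W : normedModType R) (k : nat)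
    (U : set (V * W)) (g : V * W -> R) (t : W) :
  Ck_on k U g -> Ck_on k [set x | U (x, t)] (fun x => g (x, t)).
Proof.
elim: k g => [|k IH] g [cg Cg]; split.
- by move=> x Ux; apply: continuous_slice_left; exact: cg.
- by [].
- by move=> x Ux; apply: continuous_slice_left; exact: cg.
move=> v; have [dg Cdg] := Cg (v, 0); split.
  by move=> x Ux; apply: (derive_slice_left g t x v).1; exact: dg.
have -> : 'D_v (fun x => g (x, t)) = (fun x => ('D_(v, 0) g) (x, t)).
  by apply/funext => x; rewrite (derive_slice_left g t x v).2.
exact: (IH _ Cdg).
Qed.

(** * The Euclidean inner product and semi-definite matrices *)

Section dot_product.
Variables (R : realType) (n : nat).
Implicit Types (x y z : 'rV[R]_n) (A : 'M[R]_n).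

Lemma dotC x y : dot x y = dot y x.
Proof. by apply: eq_bigr => i _; rewrite mulrC. Qed.

Lemma dotDl x y z : dot (x + y) z = dot x z + dot y z.
Proof. by rewrite -big_split; apply: eq_bigr => i _; rewrite mxE mulrDl. Qed.

Lemma dotDr x y z : dot z (x + y) = dot z x + dot z y.
Proof. by rewrite dotC dotDl !(dotC z). Qed.

Lemma dotZl a x y : dot (a *: x) y = a * dot x y.
Proof. by rewrite mulr_sumr; apply: eq_bigr => i _; rewrite mxE mulrA. Qed.

Lemma dotZr a x y : dot x (a *: y) = a * dot x y.
Proof. by rewrite dotC dotZl dotC. Qed.

Lemma dot_delta x i : dot x (delta_mx 0 i) = x 0 i.
Proof.
rewrite /dot (bigD1 i)//= mxE !eqxx mulr1 big1 ?addr0// => j ji.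
by rewrite mxE (negbTE ji) andbF mulr0.
Qed.

Lemma dot_mulmxE A x y : dot (x *m A) y = \sum_i \sum_j x 0 i * y 0 j * A i j.
Proof.
rewrite exchange_big; apply: eq_bigr => j _ /=.
by rewrite mxE mulr_suml; apply: eq_bigr => i _; rewrite mulrAC.
Qed.

Lemma dot_mulmx_delta A i j :
  dot (delta_mx 0 i *m A) (delta_mx 0 j) = A i j.
Proof. by rewrite dot_delta -rowE mxE. Qed.

Lemma dot_mulmx_sym A x y : A^T = A -> dot (x *m A) y = dot (y *m A) x.
Proof.
move=> At; rewrite !dot_mulmxE exchange_big.
apply: eq_bigr => i _; apply: eq_bigr => j _.
by rewrite -{1}At mxE [x 0 j * _]mulrC.
Qed.

Lemma dot_ge0 x : 0 <= dot x x.
Proof. by apply: sumr_ge0 => i _; rewrite -expr2 sqr_ge0. Qed.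

Lemma enorm_ge0 x : 0 <= enorm x.
Proof. exact: sqrtr_ge0. Qed.

Lemma sqr_enorm x : enorm x ^+ 2 = dot x x.
Proof. by rewrite sqr_sqrtr// dot_ge0. Qed.

Lemma enormZ a x : enorm (a *: x) = `|a| * enorm x.
Proof. by rewrite /enorm dotZl dotZr mulrA -expr2 sqrtrM ?sqr_ge0// sqrtr_sqr. Qed.

Lemma enormN x : enorm (- x) = enorm x.
Proof. by rewrite -scaleN1r enormZ normrN1 mul1r. Qed.

Lemma enorm_eq0 x : (enorm x == 0) = (x == 0).
Proof.
apply/idP/eqP => [|->]; last first.
  by rewrite /enorm -(scale0r 0) dotZl mul0r sqrtr0.
rewrite sqrtr_eq0 => x0; apply/rowP => i; rewrite mxE; apply/eqP.
rewrite -sqrf_eq0 eq_le sqr_ge0 andbT; apply: le_trans x0.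
rewrite /dot (bigD1 i)//= -expr2 lerDl; apply: sumr_ge0 => j _.
by rewrite -expr2 sqr_ge0.
Qed.

Lemma enorm_gt0 x : (0 < enorm x) = (x != 0).
Proof. by rewrite lt0r enorm_eq0 enorm_ge0 andbT. Qed.

Lemma le_coord_enorm x i : `|x 0 i| <= enorm x.
Proof.
rewrite -sqrtr_sqr; apply: ler_wsqrtr.
rewrite /dot (bigD1 i)//= -expr2 lerDl; apply: sumr_ge0 => j _.
by rewrite -expr2 sqr_ge0.
Qed.

Lemma enorm_continuous : continuous (@enorm R n).
Proof.
move=> x; apply: (@continuous_comp _ _ _ (fun x => dot x x) Num.sqrt).
  rewrite /dot; apply: continuous_big => [|i _ y].
    by move=> ?; apply: add_continuous.
  have cc : {for y, continuous (fun x : 'rV[R]_n => x 0 i)}.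
    exact: coord_continuous.
  exact: (cvgM cc cc).
exact: sqrt_continuous.
Qed.

End dot_product.

(** * The trace of a product of semi-definite matrices *)

Section psd_trace.
Variables (R : realType) (n : nat).
Implicit Types A N : 'M[R]_n.

(** On [e_j + c e_i] the quadratic form is [A j j + 2 c A i j], affine in [c]; the chosen [c] gives
    it the value -1. *)
Lemma psd_row0 A i j : A^T = A -> psd A -> A i i = 0 -> A i j = 0.
Proof.
move=> At pA Aii; apply/eqP/negPn/negP => Aij0.
have /(_ (delta_mx 0 j + (- (A j j + 1) / (2 * A i j)) *: delta_mx 0 i)) := pA.
rewrite mulmxDl -scalemxAl !dotDl !dotDr !dotZl !dotZr !dot_mulmx_delta Aii.
have -> : A j i = A i j by rewrite -{1}At mxE.
have : - (A j j + 1) / (2 * A i j) * A i j * 2 = - (A j j + 1) by field.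
lra.
Qed.

(* Cholesky elimination writes A as a sum of rank-one matrices c^T c. *)
Lemma psd_trace_le0 A N : A^T = A -> psd A ->
  (forall v : 'rV[R]_n, \sum_i \sum_j v 0 i * v 0 j * N i j <= 0) ->
  \sum_i \sum_j A i j * N i j <= 0.
Proof.
(* Induction on the number of nonzero diagonal entries; if there are none, [A] vanishes. *)
move=> + + Nle0; have [m] := ubnP #|[pred i | A i i != 0]|.
elim: m A => // m IH A cA At pA.
have [/existsP[k Akk]|] := boolP [exists k, A k k != 0]; last first.
  rewrite negb_exists => /forallP A0; rewrite big1// => i _; rewrite big1// => j _.
  by rewrite psd_row0 ?mul0r//; apply/eqP/negPn.
have Ak0 : 0 < A k k.
  by rewrite lt0r Akk -dot_mulmx_delta; exact: pA.
(* Schur complement of the pivot [A k k]. *)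
pose B := \matrix_(i, j) (A i j - A k i * A k j / A k k).
have BE x y : dot (x *m B) y = dot (x *m A) y -
    dot (delta_mx 0 k *m A) x * dot (delta_mx 0 k *m A) y / A k k.
  rewrite (dot_mulmxE B) (dot_mulmxE A) -!rowE /dot 2!mulr_suml -sumrB.
  apply: eq_bigr => i _; rewrite mulr_sumr mulr_suml -sumrB.
  apply: eq_bigr => j _; rewrite !mxE; ring.
have Bt : B^T = B.
  by apply/matrixP => i j; rewrite !mxE -{1}At mxE [A k j * _]mulrC.
have pB : psd B.
  (* The test vector is [v] moved along [e_k] to where the form of [A] is least; its value there is
     the form of [B] at [v]. *)
  move=> v; rewrite BE; set s := dot (delta_mx 0 k *m A) v.
  have := pA (v - (s / A k k) *: delta_mx 0 k).
  rewrite -scaleNr mulmxDl -scalemxAl !dotDl !dotDr !dotZl !dotZr.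
  rewrite dot_mulmx_delta (dot_mulmx_sym v (delta_mx 0 k) At) -/s.
  suff -> : - (s / A k k) * (- (s / A k k) * A k k) = (s / A k k) * s by lra.
  by field.
(* A zero diagonal entry of [A] lies in a zero row, so it stays zero in [B], and the pivot entry
   becomes zero as well. *)
have lt : (#|[pred i | (B i i != 0)%R]| < m)%N.
  rewrite ltnS in cA; apply: leq_trans cA; apply: proper_card.
  apply/properP; split.
    apply/fintype.subsetP => i; rewrite !inE; apply: contraNneq => Aii.
    have Aki : A k i = 0 by rewrite -At mxE (psd_row0 k At pA Aii).
    by rewrite mxE Aii Aki mul0r mul0r subr0.
  by exists k; rewrite !inE ?Akk// mxE mulfK ?subrr ?eqxx.
have := IH B lt Bt pB.
have := Nle0 (row k A).
have -> : \sum_i \sum_j A i j * N i j = \sum_i \sum_j B i j * N i j +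
    (\sum_i \sum_j row k A 0 i * row k A 0 j * N i j) / A k k.
  rewrite mulr_suml -big_split; apply: eq_bigr => i _ /=.
  rewrite mulr_suml -big_split; apply: eq_bigr => j _ /=.
  by rewrite !mxE; lra.
move=> le1 le2; rewrite -[leRHS]addr0; apply: lerD => //.
by rewrite mulr_le0_ge0// invr_ge0 ltW.
Qed.

End psd_trace.

(** * Ellipticity in the direction of the gradient *)

Lemma alpha_le (R : realType) (n : nat) (A : 'M[R]_n) (p v : 'rV[R]_n) :
  psd A -> alpha A p * dot v p ^+ 2 <= enorm p ^+ 2 * dot (v *m A) v.
Proof.
move=> pA; have [vp0|vp0] := eqVneq (dot v p) 0.
  by rewrite vp0 expr0n mulr0 mulr_ge0 ?sqr_ge0// pA.
have v0 : v != 0.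
  by apply: contraNneq vp0 => ->; rewrite -(scale0r 0) dotZl mul0r.
(* The quotient under the infimum is invariant under scaling of [v], so [v] is normalised; 0 bounds
   the quotients from below. *)
rewrite /alpha -mulrA ler_wpM2l ?sqr_ge0//.
rewrite -ler_pdivlMr; last by rewrite lt0r sqrf_eq0 vp0 sqr_ge0.
set c := (enorm v)^-1.
have c0 : c != 0 by rewrite invr_neq0// enorm_eq0.
apply: ge_inf.
  by exists 0 => _ [w _ <-]; rewrite divr_ge0 ?sqr_ge0// pA.
exists (c *: v).
  split; last by rewrite dotZl mulf_neq0.
  rewrite enormZ ger0_norm ?invr_ge0 ?enorm_ge0//.
  by rewrite mulVf// enorm_eq0.
rewrite -scalemxAl !dotZl dotZr exprMn; field.
by apply/andP.
Qed.

Lemma cvg_dot_mulmx (R : realType) (n : nat) (T : Type) (F : set_system T)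
    {FF : Filter F} (A : T -> 'M[R]_n) (B : 'M[R]_n) (v : 'rV[R]_n) :
  (forall i j, A s i j @[s --> F] --> B i j) ->
  dot (v *m A s) v @[s --> F] --> dot (v *m B) v.
Proof.
move=> AB; rewrite dot_mulmxE; under eq_fun do rewrite dot_mulmxE.
apply: cvg_big => [|i _]; first exact: add_continuous.
apply: cvg_big => [|j _]; first exact: add_continuous.
by apply: cvgM; [exact: cvg_cst | exact: AB].
Qed.

(** For [s != 0] this is [alpha_le] at [p = s e] with [s^2] cancelled. At [s = 0], where [alpha] is
    an infimum over the empty set, the bound is the limit of those at [r e] as [r] decreases to
    0. *)
Lemma elliptic_lower_bound (R : realType) (n : nat) (A : 'rV[R]_n -> 'M[R]_n)
    (a : R -> R) (s : R) (e v : 'rV[R]_n) :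
  (forall p, psd (A p)) ->
  (forall p, p != 0 -> alpha (A p) p = a (enorm p)) ->
  (forall i j, {for 0, continuous (fun p => A p i j)}) ->
  a r @[r --> 0^'+] --> a 0 -> enorm e = 1 ->
  a `|s| * dot v e ^+ 2 <= dot (v *m A (s *: e)) v.
Proof.
move=> pA aA cA ca e1.
have pos (r : R) : r != 0 -> a `|r| * dot v e ^+ 2 <= dot (v *m A (r *: e)) v.
  move=> r0; have re0 : r *: e != 0.
    by rewrite -enorm_eq0 enormZ e1 mulr1 normr_eq0.
  have := alpha_le (r *: e) v (pA (r *: e)).
  rewrite aA// enormZ e1 mulr1 dotZr exprMn real_normK ?num_real// mulrCA.
  by rewrite ler_pM2l// lt0r sqrf_eq0 r0 sqr_ge0.
have [->|] := eqVneq s 0; last exact: pos.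
rewrite normr0 scale0r.
apply: (@ler_cvg_to _ (0 : R)^'+ _ _ (fun r => a r * dot v e ^+ 2)
  (fun r => dot (v *m A (r *: e)) v) _ _).
- by apply: cvgM; [exact: ca | exact: cvg_cst].
- apply: cvg_dot_mulmx => i j; apply: cvg_at_right_filter.
  have : {for 0, continuous ((fun p => A p i j) \o (fun r : R => r *: e))}.
    apply: continuous_comp; last by rewrite /= scale0r; exact: cA.
    by apply: cvgZl; exact: cvg_id.
  by rewrite /prop_for /continuous_at /= scale0r.
- near=> r; have r0 : 0 < r by [].
  by have := pos r; rewrite gtr0_norm//; apply; rewrite gt_eqF.
Unshelve. all: by end_near. Qed.

(** * First and second order conditions at a maximum *)

(** The squared norm is a quadratic polynomial [q] in [s], positive at 0, to which the chain rule
    with the square root applies. *)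
Lemma is_derive_enorm (R : realType) (n : nat) (d v : 'rV[R]_n) : d != 0 ->
  is_derive (0 : R) 1 (fun s => enorm (d + s *: v)) (dot d v / enorm d).
Proof.
move=> d0; have en0 : enorm d != 0 by rewrite enorm_eq0.
pose q (s : R) := dot d d + (2 * dot d v) * s + dot v v * s ^+ 2.
have -> : (fun s => enorm (d + s *: v)) = Num.sqrt \o q.
  apply/funext => s; rewrite /enorm /q /= !dotDl !dotDr !dotZl !dotZr (dotC v d).
  by congr Num.sqrt; ring.
have q0 : q 0 = dot d d by rewrite /q expr0n !mulr0 !addr0.
have dq : is_derive (0 : R) 1 q (2 * dot d v).
  by apply: is_derive_eq; rewrite /GRing.scale /=; ring.
have dd : 0 < q 0 by rewrite q0 -sqr_enorm lt0r sqrf_eq0 en0 sqr_ge0.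
have := is_derive1_comp (is_derive1_sqrt dd) dq.
rewrite q0 -/(enorm d).
have -> // : (2 * enorm d)^-1 * (2 * dot d v) = dot d v / enorm d.
by field.
Qed.

Section line_derivatives.
Variables (R : realType) (n : nat) (f : 'rV[R]_n -> R).
Hypothesis Cf : Ck_on 2 setT f.

Lemma is_derive_line (x v : 'rV[R]_n) (s : R) :
  is_derive s 1 (fun s => f (x + s *: v)) ('D_v f (x + s *: v)).
Proof. by apply/is_derive_lineP; apply: derivableP; exact: (Ck2_derivable Cf). Qed.

Lemma is_derive_line2 (x v : 'rV[R]_n) (s : R) :
  is_derive s 1 (fun s => 'D_v f (x + s *: v)) ('D_v ('D_v f) (x + s *: v)).
Proof.
apply/(is_derive_lineP ('D_v f)); apply: derivableP.
exact: (Ck2_derive2_derivable Cf).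
Qed.

(** Moving both points by the same vector gives a function of one variable along each [v], maximal
    at [s = 0], to which the second derivative test applies. *)
Lemma max_translations (x y : 'rV[R]_n) :
  (forall xi, f (y + xi) - f (x + xi) <= f y - f x) ->
  gradient f x = gradient f y /\
  forall v, 'D_v ('D_v f) y - 'D_v ('D_v f) x <= 0.
Proof.
move=> fmax.
have test v : 'D_v f y - 'D_v f x = 0 /\ 'D_v ('D_v f) y - 'D_v ('D_v f) x <= 0.
  pose g (s : R) := f (y + s *: v) - f (x + s *: v).
  pose g1 (s : R) := 'D_v f (y + s *: v) - 'D_v f (x + s *: v).
  have dg (s : R) : is_derive s 1 g (g1 s).
    by apply: is_deriveB; exact: is_derive_line.
  have dg1 : is_derive (0 : R) 1 g1 ('D_v ('D_v f) y - 'D_v ('D_v f) x).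
    rewrite -[y]addr0 -[x]addr0 -(scale0r v).
    by apply: is_deriveB; exact: is_derive_line2.
  have ndg : \forall s \near (0 : R), is_derive (s : R) 1 g (g1 s).
    by near=> s; exact: dg.
  have gmax : \forall s \near (0 : R), g s <= g 0.
    by near=> s; rewrite /g scale0r !addr0; exact: fmax.
  have [] := second_derivative_test ndg dg1 gmax.
  by rewrite /g1 scale0r !addr0.
split; last by move=> v; have [] := test v.
by apply/rowP => i; rewrite !mxE; apply/esym/subr0_eq; have [] := test (delta_mx 0 i).
Unshelve. all: by end_near. Qed.

Variables (psi psi1 : R -> R) (psi2 : R) (x d e : 'rV[R]_n).
Let z := enorm d.
Hypotheses (z0 : 0 < z) (eE : e = z^-1 *: d).
Hypothesis dpsi : \forall s \near z, is_derive (s : R) 1 psi (psi1 s).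
Hypothesis dpsi1 : is_derive (z : R) 1 psi1 psi2.
Hypothesis fmax : forall x' d',
  f (x' + d') - f x' - psi (enorm d') <= f (x + d) - f x - psi z.

(** With [x] fixed, [d] varies along a coordinate direction; the first derivatives of [f] and of
    [psi (enorm d)] must balance. *)
Lemma max_spread_gradient : gradient f (x + d) = psi1 z *: e.
Proof.
have d0 : d != 0 by rewrite -enorm_gt0.
apply/rowP => i; rewrite !mxE eE mxE; set v := delta_mx 0 i : 'rV[R]_n.
have de := is_derive_enorm v d0.
have dpsiz : is_derive (enorm (d + 0 *: v)) 1 psi (psi1 z).
  by rewrite scale0r addr0; exact: nbhs_singleton dpsi.
have dcomp := @is_derive1_comp _ psi (fun s => enorm (d + s *: v)) 0 _ _ dpsiz de.
have df := is_derive_line (x + d) v 0.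
have := max_derive_eq0 (is_deriveB df dcomp).
rewrite !fctE scale0r !addr0 dot_delta -/z => dE.
rewrite /partial -/v; apply/subr0_eq; rewrite [z^-1 * _]mulrC; apply: dE => s.
have := fmax x (d + s *: v); rewrite addrA.
by move=> /=; lra.
Qed.

(** The points move by [s e] and [- s e], so their distance is [z + 2 s] and [psi] contributes its
    second derivative times [2^2]. *)
Lemma max_spread_second :
  'D_e ('D_e f) (x + d) - 'D_e ('D_e f) x <= 4 * psi2.
Proof.
have d0 : d != 0 by rewrite -enorm_gt0.
have e1 : enorm e = 1.
  by rewrite eE enormZ ger0_norm ?invr_ge0 ?enorm_ge0// mulVf// gt_eqF.
(* For such [s], [z + 2 s] is positive and equals the norm of [(z + 2 s) e]. *)
have half (s : R) : `|s| < z / 2 -> - z < 2 * s.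
  by rewrite ltr_norml => /andP[]; lra.
have line (s : R) : - z < 2 * s -> enorm (d + (2 * s) *: e) = z + 2 * s.
  move=> zs; have -> : d = z *: e by rewrite eE scalerA divff ?scale1r// gt_eqF.
  by rewrite -scalerDl enormZ e1 mulr1 gtr0_norm//; lra.
pose g (s : R) := f ((x + d) + s *: e) - f (x + s *: - e) - psi (z + 2 * s).
pose g1 (s : R) := 'D_e f ((x + d) + s *: e) - 'D_(- e) f (x + s *: - e)
  - 2 * psi1 (z + 2 * s).
have dz (s : R) : is_derive s 1 (fun s => z + 2 * s) 2.
  by apply: is_derive_eq; rewrite /GRing.scale /=; ring.
have cz : z + 2 * s @[s --> (0 : R)] --> z.
  have : {for (0 : R), continuous (fun s : R => z + 2 * s)}.
    by apply: differentiable_continuous; apply/derivable1_diffP; case: (dz 0).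
  by rewrite /prop_for /continuous_at mulr0 addr0.
have dg : \forall s \near (0 : R), is_derive (s : R) 1 g (g1 s).
  have : \forall s \near (0 : R), is_derive (z + 2 * s) 1 psi (psi1 (z + 2 * s)).
    exact: (cz _ dpsi).
  apply: filterS => s ds.
  have dcomp := @is_derive1_comp _ psi (fun s => z + 2 * s) s _ _ ds (dz s).
  rewrite mulrC in dcomp; exact: (is_deriveB (is_deriveB (is_derive_line (x + d) e s)
    (is_derive_line x (- e) s)) dcomp).
have DNE : 'D_(- e) ('D_(- e) f) x = 'D_e ('D_e f) x.
  rewrite !Ck2_dir2E//; apply: eq_bigr => i _; apply: eq_bigr => j _.
  by rewrite !mxE mulrNN.
have dg1 : is_derive (0 : R) 1 g1
    ('D_e ('D_e f) (x + d) - 'D_e ('D_e f) x - 2 * (psi2 * 2)).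
  have dpsi1' : is_derive (z + 2 * 0) 1 psi1 psi2 by rewrite mulr0 addr0.
  have d1 := @is_derive1_comp _ psi1 (fun s => z + 2 * s) 0 _ _ dpsi1' (dz 0).
  have d2 := is_derive_line2 (x + d) e 0.
  have d3 := is_derive_line2 x (- e) 0.
  rewrite scale0r addr0 in d2; rewrite scale0r addr0 DNE in d3.
  exact: (is_deriveB (is_deriveB d2 d3) (is_deriveZ 2 d1)).
have gmax : \forall s \near (0 : R), g s <= g 0.
  near=> s; rewrite /g !scale0r mulr0 !addr0 -line; last first.
    near: s; exists (z / 2) => /=; first by rewrite divr_gt0.
    by move=> s /=; rewrite sub0r normrN; exact: half.
  have := fmax (x + s *: - e) (d + (2 * s) *: e).
  suff -> : x + s *: - e + (d + (2 * s) *: e) = x + d + s *: e by [].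
  rewrite addrACA scalerN -scaleNr -scalerDl; congr (_ + _ *: _); ring.
have -> : 4 * psi2 = 2 * (psi2 * 2) by ring.
have [_ dle0] := second_derivative_test dg dg1 gmax.
by rewrite -subr_le0.
Unshelve. all: by end_near. Qed.

End line_derivatives.

(** * The maximum principle *)

Definition box (R : realType) (n : nat) (r : R) : set 'rV[R]_n :=
  [set x | forall i, `[- r, r]%classic (x ord0 i)].

Lemma box_compact (R : realType) (n : nat) (r : R) : compact (@box R n r).
Proof.
by apply: (@rV_compact _ n (fun=> `[- r, r]%classic)) => i; exact: segment_compact.
Qed.

Lemma not_box (R : realType) (n : nat) (r : R) (x : 'rV[R]_n) :
  ~ box r x -> r < enorm x.
Proof.
move=> /existsNP[i]; rewrite /= in_itv /= -ler_norml => /negP.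
by rewrite -ltNge => /lt_le_trans; apply; exact: le_coord_enorm.
Qed.

(** Subtracting the integer parts of the coordinates in the basis [B] leaves coordinates in [0, 1),
    hence a bound by the entries of [B]. *)
Lemma lattice_box (R : realType) (n : nat) (G : set 'rV[R]_n) : is_lattice G ->
  exists r, forall x, exists2 g, G g & box r (x + g).
Proof.
move=> [B Bu ->]; exists (\sum_i \sum_j `|B i j|) => x.
have [c xE] : exists c, x = c *m B by exists (x *m invmx B); rewrite mulmxKV.
exists (map_mx (fun k : int => k%:~R) (\row_j (- Num.floor (c 0 j))) *m B).
  by exists (\row_j - Num.floor (c 0 j)).
rewrite {1}xE -mulmxDl => j; rewrite /= in_itv /= -ler_norml !mxE.
apply: (le_trans (ler_norm_sum _ _ _)); apply: ler_sum => i _.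
rewrite (bigD1 j)//= -[leLHS]addr0; apply: lerD; last exact: sumr_ge0.
rewrite normrM ler_piMl// !mxE ler_norml rmorphN /=.
have := floor_itv (c 0 i); rewrite intrD mulr1z => /andP[]; lra.
Qed.

Lemma sum_entriesB (R : pzRingType) (m n : nat) (c : 'I_m -> 'I_n -> R)
    (A B : 'M[R]_(m, n)) :
  \sum_i \sum_j c i j * (A - B) i j =
  \sum_i \sum_j c i j * A i j - \sum_i \sum_j c i j * B i j.
Proof.
rewrite -sumrB; apply: eq_bigr => i _; rewrite -sumrB.
by apply: eq_bigr => j _; rewrite !mxE mulrBr.
Qed.

Definition hessian (R : realType) (n : nat) (f : 'rV[R]_n -> R) (x : 'rV[R]_n) :=
  \matrix_(i, j) partial i (partial j f) x.

Section parabolic.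
Variables (R : realType) (n : nat) (T M : R).
Variables (A : 'rV[R]_n -> R -> 'M[R]_n) (b : 'rV[R]_n -> R -> R).
Variables (G : set 'rV[R]_n) (u : 'rV[R]_n -> R -> R) (ut : 'rV[R]_n * R -> R).
Hypothesis psdA : forall p t, 0 <= t <= T -> (A p t)^T = A p t /\ psd (A p t).
Hypothesis uC2 : forall t, 0 <= t <= T -> Ck_on 2 setT (u^~ t).
Hypothesis uD : forall x t, 0 < t < T -> derivable (u x) t 1.
Hypothesis utc : continuous ut.
Hypothesis utE : forall x t, 0 <= t <= T -> u x t = ut (x, t).
Hypothesis pde : forall x t, 0 < t < T ->
  (u x)^`()%classic t = \sum_(i < n) \sum_(j < n)
    A (gradient (u^~ t) x) t i j * partial i (partial j (u^~ t)) x
  + b (gradient (u^~ t) x) t.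
Hypothesis latG : is_lattice G.
Hypothesis uG : forall x g t, G g -> 0 <= t <= T -> u (x + g) t = u x t.
Hypothesis osc0 : forall x y, u y 0 - u x 0 <= M.

Lemma hess_dir t x v : 0 <= t <= T ->
  'D_v ('D_v (u^~ t)) x = \sum_i \sum_j v 0 i * v 0 j * hessian (u^~ t) x i j.
Proof.
move=> tT; rewrite Ck2_dir2E; last exact: uC2.
by apply: eq_bigr => i _; apply: eq_bigr => j _; rewrite mxE.
Qed.

Lemma hess_dirB t x y v : 0 <= t <= T ->
  'D_v ('D_v (u^~ t)) y - 'D_v ('D_v (u^~ t)) x =
  \sum_i \sum_j v 0 i * v 0 j * (hessian (u^~ t) y - hessian (u^~ t) x) i j.
Proof.
move=> tT; rewrite (hess_dir x v tT) (hess_dir y v tT).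
by rewrite (sum_entriesB (fun i j => v 0 i * v 0 j)).
Qed.

(* The term b depends on Du only, so it cancels. *)
Lemma derive1_diff x y t : 0 < t < T ->
  gradient (u^~ t) x = gradient (u^~ t) y ->
  (u y)^`()%classic t - (u x)^`()%classic t =
  \sum_i \sum_j A (gradient (u^~ t) y) t i j *
    (hessian (u^~ t) y - hessian (u^~ t) x) i j.
Proof.
move=> tT g; rewrite (pde y tT) (pde x tT) g.
have addKB (r s q : R) : r + q - (s + q) = r - s by ring.
rewrite addKB (sum_entriesB (fun i j => A (gradient (u^~ t) y) t i j)).
congr (_ - _); apply: eq_bigr => i _; apply: eq_bigr => j _.
all: by rewrite [hessian _ _ _ _]mxE.
Qed.

Lemma is_derive_time x t : 0 < t < T ->
  is_derive t 1 (u x) ((u x)^`()%classic t).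
Proof. by move=> tT; rewrite derive1E; apply: derivableP; exact: uD. Qed.

(** One translate serves all [d] and [t] at once, so maximising over [x] reduces to a compact
    box. *)
Lemma cell_transl : exists r, forall x, exists2 x', box r x' &
  forall d t, 0 <= t <= T -> u (x' + d) t = u (x + d) t.
Proof.
have [r rP] := lattice_box latG; exists r => x; have [g Gg bg] := rP x.
exists (x + g); first exact: bg.
by move=> d t tT; rewrite addrAC (uG (x + d) Gg tT).
Qed.

(* For each fixed d, the maximum over x of u(x + d, t) - u(x, t) is
   nonincreasing in t. *)
Lemma osc_le x d t : 0 <= t < T -> u (x + d) t - u x t <= M.
Proof.
move=> /andP[t0 tT]; apply/ler_addgt0Pr => e0 e0_gt0.
(* The penalty [e * t] forces a strictly negative time derivative at a maximum with positive time;
   this [e] keeps it below [e0]. *)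
pose e := e0 / (1 + t); have t1 : 0 < 1 + t by lra.
have e_gt0 : 0 < e by rewrite divr_gt0.
suff : u (x + d) t - u x t - e * t <= M.
  suff : e * t <= e0 by lra.
  by rewrite /e mulrAC ler_pdivrMr// ler_wpM2l ?ltW//; lra.
have [r rP] := cell_transl.
pose F (p : 'rV[R]_n * R) := ut (p.1 + d, p.2) - ut p - e * p.2.
have cF : continuous F.
  move=> p; have c1 : {for p, continuous (fun p : 'rV[R]_n * R => (p.1 + d, p.2))}.
    have cD : q.1 + d @[q --> p] --> p.1 + d.
      by apply: cvgD; [exact: cvg_fst | exact: cvg_cst].
    exact: (cvg_pair cD cvg_snd).
  have c2 := @continuous_comp _ _ _ (fun p : 'rV[R]_n * R => (p.1 + d, p.2)) ut p
    c1 (@utc _).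
  have c3 : {for p, continuous (fun p : 'rV[R]_n * R => e * p.2)}.
    exact: (cvgM (cvg_cst e) cvg_snd).
  exact: (cvgB (cvgB c2 (@utc p)) c3).
have FE y s : 0 <= s <= T -> F (y, s) = u (y + d) s - u y s - e * s.
  by move=> sT; rewrite /F /= -!utE.
have [x' bx' _] := rP x.
pose K := box r `*` `[0, t]%classic : set ('rV[R]_n * R).
have cK : compact K.
  by apply: compact_setX; [exact: box_compact | exact: segment_compact].
have K0 : K !=set0 by exists (x', 0); split => //=; rewrite in_itv /= lexx t0.
have [[x1 s1] + Kmax] := compact_EVT_max K0 cK (continuous_subspaceT cF).
rewrite inE => -[/= bx1]; rewrite in_itv /= => /andP[s10 s1t].
have s1T : 0 <= s1 <= T by lra.
have tT' : 0 <= t <= T by lra.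
have gmax y s : 0 <= s <= t ->
    u (y + d) s - u y s - e * s <= u (x1 + d) s1 - u x1 s1 - e * s1.
  move=> /andP[s0 st]; have sT : 0 <= s <= T by lra.
  have [y' by' yE] := rP y.
  have yE0 : u y' s = u y s by have := yE 0 s sT; rewrite !addr0.
  rewrite -(yE d s sT) -yE0 -!FE//.
  by apply: Kmax; rewrite inE; split => //=; rewrite in_itv /= s0 st.
apply: (le_trans (gmax x t _)); first by rewrite t0 lexx.
have [s1_eq0|s1_neq0] := eqVneq s1 0.
  by rewrite s1_eq0 mulr0 subr0.
have s1_gt0 : 0 < s1 by rewrite lt0r s1_neq0.
have s1T' : 0 < s1 < T by lra.
(* [d] is fixed and [x] free, so both points can be translated together. *)
have [grad nsd] : gradient (u^~ s1) x1 = gradient (u^~ s1) (x1 + d) /\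
    forall v, 'D_v ('D_v (u^~ s1)) (x1 + d) - 'D_v ('D_v (u^~ s1)) x1 <= 0.
  apply: (max_translations (uC2 s1T)) => xi.
  have := gmax (x1 + xi) s1; rewrite s10 s1t (addrAC x1 xi d) => /(_ isT) /=; lra.
have [At pA] := psdA (gradient (u^~ s1) (x1 + d)) s1T.
have := derive1_diff s1T' grad.
have := @psd_trace_le0 _ _ _
  (hessian (u^~ s1) (x1 + d) - hessian (u^~ s1) x1) At pA.
have {}nsd (v : 'rV[R]_n) : \sum_i \sum_j v 0 i * v 0 j *
    (hessian (u^~ s1) (x1 + d) - hessian (u^~ s1) x1) i j <= 0.
  by have := nsd v; rewrite hess_dirB.
move=> /(_ nsd) tr E.
have dF := is_deriveB (is_deriveB (is_derive_time (x1 + d) s1T')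
  (is_derive_time x1 s1T')) (is_deriveZ e (is_derive_id s1 1)).
have : 0 <= (u (x1 + d))^`()%classic s1 - (u x1)^`()%classic s1 - e%:A.
  apply: (left_max_derive_ge0 s1_gt0 dF) => s /andP[s_gt0 ss1].
  by apply: gmax; rewrite (ltW s_gt0) (le_trans ss1 s1t).
by rewrite E [e%:A]mulr1 subr_ge0 => /le_trans/(_ tr); rewrite leNgt e_gt0.
Qed.

(** * Comparison of the two-point difference with [psi] *)

Variables (S : R) (a : R -> R) (psi psi1 psi2 : R -> R -> R) (psit : R * R -> R).
Hypothesis ST : S <= T.
Hypothesis a_gt0 : forall s : R, 0 <= s -> 0 < a s.
Hypothesis ell : forall (t s : R) (e v : 'rV[R]_n), 0 < t < S -> enorm e = 1 ->
  a `|s| * dot v e ^+ 2 <= dot (v *m A (s *: e) t) v.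
Hypothesis psi_ge0 : forall z t : R, 0 <= z -> 0 < t < S -> 0 <= psi z t.
Hypothesis psi_0 : forall z : R, 0 < z -> psi z 0 = M.
Hypothesis psi_far : forall e : R, 0 < e ->
  exists r, forall z t : R, r < z -> 0 < t < S -> M - e <= psi z t.
Hypothesis psitE : forall z t : R, 0 < z -> 0 <= t < S -> psi z t = psit (z, t).
Hypothesis psitc : forall z t : R, 0 < z -> {for (z, t), continuous psit}.
Hypothesis dpsi : forall z t : R, 0 < z -> 0 < t < S ->
  [/\ is_derive z 1 (psi^~ t) (psi1 z t), is_derive z 1 (psi1^~ t) (psi2 z t) &
     is_derive t 1 (psi z) (4 * a `|psi1 z t| * psi2 z t)].

(* The ellipticity bound makes A - a e^T e positive semi-definite: translations
   of the pair control this part of the trace, spreading the pair along e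
   controls the rest. *)
Lemma trace_max x d t : 0 < t < S -> d != 0 ->
  (forall x' d', u (x' + d') t - u x' t - psi (enorm d') t <=
    u (x + d) t - u x t - psi (enorm d) t) ->
  (u (x + d))^`()%classic t - (u x)^`()%classic t <=
  4 * a `|psi1 (enorm d) t| * psi2 (enorm d) t.
Proof.
move=> tS d0 gmax.
have tT : 0 < t < T by case/andP: tS => -> /lt_le_trans; apply.
have tT' : 0 <= t <= T by case/andP: tT => /ltW -> /ltW ->.
have z0 : 0 < enorm d by rewrite enorm_gt0.
have [grad nsd] : gradient (u^~ t) x = gradient (u^~ t) (x + d) /\
    forall v, 'D_v ('D_v (u^~ t)) (x + d) - 'D_v ('D_v (u^~ t)) x <= 0.
  apply: (max_translations (uC2 tT')) => xi.
  by have := gmax (x + xi) d; rewrite (addrAC x xi d) lerD2r.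
have [_ d2 _] := dpsi z0 tS.
have d1 : \forall z \near enorm d, is_derive (z : R) 1 (psi^~ t) (psi1 z t).
  near=> z; have z_gt0 : 0 < z by near: z; exact: lt_nbhsr.
  by case: (dpsi z_gt0 tS).
have := @max_spread_gradient _ _ _ (uC2 tT') _ (psi1^~ t) x d _ z0 erefl d1 gmax.
have := @max_spread_second _ _ _ (uC2 tT') _ _ _ x d _ z0 erefl d1 d2 gmax.
set e := _ *: d => spread gradE.
have e1 : enorm e = 1.
  by rewrite enormZ ger0_norm ?invr_ge0 ?enorm_ge0// mulVf// gt_eqF.
rewrite (derive1_diff tT grad) gradE.
set p := psi1 (enorm d) t; set N := hessian _ _ - _.
have [At pA] := psdA (p *: e) tT'.
pose B := A (p *: e) t - a `|p| *: (e^T *m e).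
have BE i j : A (p *: e) t i j = B i j + a `|p| * (e 0 i * e 0 j).
  by rewrite !mxE big_ord1 !mxE subrK.
have Bt : B^T = B.
  apply/matrixP => i j; rewrite mxE; apply: (addIr (a `|p| * (e 0 i * e 0 j))).
  by rewrite -BE (mulrC (e 0 i)) -BE -[in LHS]At mxE.
have pB : psd B.
  move=> v; have := ell p v tS e1.
  suff -> : dot (v *m A (p *: e) t) v = dot (v *m B) v + a `|p| * dot v e ^+ 2.
    by rewrite lerDr.
  rewrite !dot_mulmxE expr2 {1}/dot mulr_suml mulr_sumr -big_split.
  apply: eq_bigr => i _ /=; rewrite mulr_sumr mulr_sumr -big_split.
  by apply: eq_bigr => j _ /=; rewrite BE; ring.
have NE (v : 'rV[R]_n) : \sum_i \sum_j v 0 i * v 0 j * N i j =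
    'D_v ('D_v (u^~ t)) (x + d) - 'D_v ('D_v (u^~ t)) x.
  by rewrite hess_dirB.
have trB : \sum_i \sum_j B i j * N i j <= 0.
  by apply: psd_trace_le0 => // v; rewrite NE.
have -> : \sum_i \sum_j A (p *: e) t i j * N i j =
    \sum_i \sum_j B i j * N i j + a `|p| * \sum_i \sum_j e 0 i * e 0 j * N i j.
  rewrite mulr_sumr -big_split; apply: eq_bigr => i _ /=.
  rewrite mulr_sumr -big_split; apply: eq_bigr => j _ /=.
  by rewrite BE; ring.
rewrite NE -[leRHS]add0r; apply: lerD => //.
rewrite [4 * _]mulrC -mulrA ler_pM2l//; exact: a_gt0.
Unshelve. all: by end_near. Qed.

Lemma doubling x d t : 0 < t < S -> u (x + d) t - u x t <= psi (enorm d) t.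
Proof.
move=> tS; have /andP[t_gt0 ltS] := tS.
have [->|d0] := eqVneq d 0.
  by rewrite addr0 subrr psi_ge0// enorm_ge0.
rewrite leNgt; apply/negP => H.
(* [eps] is scaled so that [Z] vanishes exactly at the point where the bound is assumed to fail; the
   maximum of [Z] is then nonnegative. *)
pose eps := (u (x + d) t - u x t - psi (enorm d) t) / (1 + t).
have tp1_gt0 : 0 < 1 + t by rewrite addr_gt0.
have eps_gt0 : 0 < eps by rewrite divr_gt0// subr_gt0.
pose Z y c s := u (y + c) s - u y s - psi (enorm c) s - eps * (1 + s).
have Zxd : Z x d t = 0 by rewrite /Z /eps divfK ?subrr// gt_eqF.
have [r rP] := cell_transl.
have [r1 far] := psi_far eps_gt0.
pose F (p : 'rV[R]_n * ('rV[R]_n * R)) :=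
  ut (p.1 + p.2.1, p.2.2) - ut (p.1, p.2.2).
(* [Zt] is [Z] written with the continuous extensions; the two agree for [c != 0] and times in [0,
   S). *)
pose Zt (p : 'rV[R]_n * ('rV[R]_n * R)) :=
  F p - psit (enorm p.2.1, p.2.2) - eps * (1 + p.2.2).
have cp1 (p : 'rV[R]_n * ('rV[R]_n * R)) : q.1 @[q --> p] --> p.1.
  exact: cvg_fst.
have cp21 (p : 'rV[R]_n * ('rV[R]_n * R)) : q.2.1 @[q --> p] --> p.2.1.
  exact: (cvg_comp _ _ cvg_snd cvg_fst).
have cp22 (p : 'rV[R]_n * ('rV[R]_n * R)) : q.2.2 @[q --> p] --> p.2.2.
  exact: (cvg_comp _ _ cvg_snd cvg_snd).
pose X : set ('rV[R]_n * ('rV[R]_n * R)) := box r `*` (box r1 `*` `[0, t]%classic).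
have cF : continuous F.
  move=> p; have cl : {for p, continuous
      (fun p : 'rV[R]_n * ('rV[R]_n * R) => (p.1 + p.2.1, p.2.2))}.
    exact: (cvg_pair (cvgD (cp1 p) (cp21 p)) (cp22 p)).
  have cr : {for p, continuous
      (fun p : 'rV[R]_n * ('rV[R]_n * R) => (p.1, p.2.2))}.
    exact: (cvg_pair (cp1 p) (cp22 p)).
  have c1 := @continuous_comp _ _ _
    (fun p : 'rV[R]_n * ('rV[R]_n * R) => (p.1 + p.2.1, p.2.2)) ut p cl (@utc _).
  have c2 := @continuous_comp _ _ _
    (fun p : 'rV[R]_n * ('rV[R]_n * R) => (p.1, p.2.2)) ut p cr (@utc _).
  exact: (cvgB c1 c2).
have FE y c s : 0 <= s <= T -> F (y, (c, s)) = u (y + c) s - u y s.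
  by move=> sT; rewrite /F /= -!utE.
have ZtE y c s : 0 < enorm c -> 0 <= s < S -> Zt (y, (c, s)) = Z y c s.
  move=> c0 /andP[s0 sS]; rewrite /Zt /Z psitE ?s0// -FE// s0.
  exact: le_trans (ltW sS) ST.
(* d <> 0 on the compact set K, so that Zt is continuous there, and any point
   where Z is nonnegative is a lattice translate of a point of K: the maximum
   over K is a global one. *)
pose K := X `&` [set p | eps <= F p].
have cK : compact K.
  apply: compact_closedI.
    apply: compact_setX; first exact: box_compact.
    by apply: compact_setX; [exact: box_compact | exact: segment_compact].
  have cFge : closed (F @^-1` [set s | eps <= s]).
    by apply: preimage_closed; [move=> p _; exact: (@cF p) | exact: closed_ge].
  exact: cFge.
have inK y c s : 0 < s <= t -> 0 <= Z y c s ->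
    exists2 y', K (y', (c, s)) & Zt (y', (c, s)) = Z y c s.
  move=> /andP[s_gt0 st] Z_ge0.
  have sS : 0 < s < S by rewrite s_gt0 (le_lt_trans st ltS).
  have sT : 0 <= s <= T by rewrite ltW//= (le_trans st)// (le_trans (ltW ltS)).
  have es_gt0 : 0 < eps * s by rewrite mulr_gt0.
  (* Since [psi >= 0], the two values of [u] differ by at least [eps], which excludes [c = 0]. *)
  have ge_eps : eps <= u (y + c) s - u y s.
    have := psi_ge0 (enorm_ge0 c) sS; move: Z_ge0; rewrite /Z; lra.
  have c0 : c != 0.
    by apply: contraTneq ge_eps => ->; rewrite addr0 subrr -ltNge.
  have bc : box r1 c.
    (* Outside the box, [psi >= M - eps] and [osc_le] give [Z <= - eps * s < 0]. *)
    apply: contrapT => /not_box /far /(_ sS) ge_psi.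
    have sT' : 0 <= s < T by rewrite ltW//= (le_lt_trans st)// (lt_le_trans ltS).
    have := osc_le y c sT'; move: Z_ge0; rewrite /Z; lra.
  have [y' by' yE] := rP y; have yE0 : u y' s = u y s.
    by have := yE 0 s sT; rewrite !addr0.
  exists y'; last first.
    rewrite ZtE ?enorm_gt0//; last by case/andP: sS => /ltW -> ->.
    by rewrite /Z yE// yE0.
  split; last by rewrite /= FE// yE// yE0.
  by split=> //; split=> //=; rewrite in_itv /= ltW.
have [x' Kx' Ztx'] : exists2 x', K (x', (d, t)) & Zt (x', (d, t)) = Z x d t.
  by apply: inK; rewrite ?Zxd// t_gt0 lexx.
have KP p : K p -> 0 < enorm p.2.1.
  move=> [_ /= Fp]; rewrite enorm_gt0; apply: contraTneq Fp => p0.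
  by rewrite /F p0 addr0 subrr -ltNge.
have cZt : {within K, continuous Zt}.
  apply: continuous_in_subspaceT => p; rewrite inE => /KP p0.
  have cl : {for p, continuous
      (fun p : 'rV[R]_n * ('rV[R]_n * R) => (enorm p.2.1, p.2.2))}.
    exact: (cvg_pair (continuous_comp (cp21 p) (@enorm_continuous _ _ _)) (cp22 p)).
  have cpsi := @continuous_comp _ _ _ 
    (fun p : 'rV[R]_n * ('rV[R]_n * R) => (enorm p.2.1, p.2.2)) psit p cl
    (@psitc _ _ p0).
  have c3 : eps * (1 + q.2.2) @[q --> p] --> eps * (1 + p.2.2).
    by apply: cvgM; [exact: cvg_cst | apply: cvgD; [exact: cvg_cst | exact: cp22]].
  exact: (cvgB (cvgB (@cF p) cpsi) c3).
have K0 : K !=set0 by exists (x', (d, t)).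
have [[x1 [d1 t1]] + Kmax] := compact_EVT_max K0 cK cZt.
rewrite inE => K1; have z1_gt0 := KP _ K1; rewrite /= in z1_gt0.
case: (K1) => -[/= _ [_]]; rewrite in_itv /= => /andP[t1_ge0 t1t] F1.
have Zt1_ge0 : 0 <= Zt (x1, (d1, t1)).
  by rewrite -Zxd -Ztx'; apply: Kmax; rewrite inE.
have S_gt0 : 0 < S by exact: lt_trans ltS.
have T_gt0 : 0 < T by exact: lt_le_trans ST.
(* At time 0, [psi = M] and [osc_le] give [Z <= - eps]. *)
have t1_gt0 : 0 < t1.
  rewrite lt0r t1_ge0 andbT; apply: contraTneq Zt1_ge0 => t1_eq0.
  have T0 : 0 <= (0 : R) < T by rewrite lexx.
  rewrite t1_eq0 ZtE ?lexx// /Z psi_0// -ltNge.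
  have := osc_le x1 d1 T0; lra.
have t1S : 0 < t1 < S by rewrite t1_gt0 (le_lt_trans t1t).
have t1T : 0 < t1 < T by rewrite t1_gt0 (lt_le_trans _ ST)//; case/andP: t1S.
have Zt1 : Zt (x1, (d1, t1)) = Z x1 d1 t1.
  by apply: ZtE => //; case/andP: t1S => /ltW -> ->.
(* A negative value lies below the nonnegative maximum; for the others [inK] moves the point into
   [K]. *)
have gmax y c s : 0 < s <= t -> Z y c s <= Z x1 d1 t1.
  move=> st; have [Zneg|Zpos] := ltP (Z y c s) 0.
    by rewrite -Zt1 (le_trans (ltW Zneg)).
  have [y' Ky' <-] := inK y c s st Zpos.
  by rewrite -Zt1; apply: Kmax; rewrite inE.
have d1_neq0 : d1 != 0 by rewrite -enorm_gt0.
have le0 : (u (x1 + d1))^`()%classic t1 - (u x1)^`()%classic t1 <=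
    4 * a `|psi1 (enorm d1) t1| * psi2 (enorm d1) t1.
  apply: trace_max => // y c; have := gmax y c t1.
  by rewrite t1_gt0 t1t /Z => /(_ isT); lra.
have [_ _ dpsit] := dpsi z1_gt0 t1S.
have dF := is_deriveB (is_deriveB (is_deriveB (is_derive_time (x1 + d1) t1T)
  (is_derive_time x1 t1T)) dpsit) (is_deriveZ eps (is_derive_id t1 1)).
(* [t1] may be the endpoint [t], so only times up to [t1] are compared. *)
have : 0 <= (u (x1 + d1))^`()%classic t1 - (u x1)^`()%classic t1
    - 4 * a `|psi1 (enorm d1) t1| * psi2 (enorm d1) t1 - eps%:A.
  apply: (left_max_derive_ge0 t1_gt0 dF) => s /andP[s_gt0 st1].
  have := gmax x1 d1 s; rewrite s_gt0 (le_trans st1 t1t) => /(_ isT).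
  by rewrite /Z !fctE /= /GRing.scale /=; lra.
rewrite [eps%:A]mulr1 subr_ge0 => /(lt_le_trans eps_gt0).
by rewrite ltNge subr_le0 le0.
Qed.

End parabolic.

(* The parabola w(y, s) = M - q ((y - z)^2 + K s) is a strict subsolution on
   |y - z| <= L as long as its slope stays in the range where a is bounded;
   letting L grow makes w(z, t) tend to M. *)
Lemma half_line_lower_bound (R : realType) (S M : R) (a : R -> R)
    (psi psi1 psi2 : R -> R -> R) (psit : R * R -> R) :
  0 < M -> (forall s : R, 0 <= s -> 0 < a s) -> a s @[s --> 0^'+] --> a 0 ->
  (forall z t : R, 0 <= z -> 0 < t < S -> 0 <= psi z t) ->
  (forall z : R, 0 < z -> psi z 0 = M) ->
  (forall z t : R, 0 < z -> 0 <= t < S -> psi z t = psit (z, t)) ->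
  (forall z t : R, 0 < z -> {for (z, t), continuous psit}) ->
  (forall z t : R, 0 < z -> 0 < t < S ->
    [/\ is_derive z 1 (psi^~ t) (psi1 z t), is_derive z 1 (psi1^~ t) (psi2 z t) &
       is_derive t 1 (psi z) (4 * a `|psi1 z t| * psi2 z t)]) ->
  forall e : R, 0 < e ->
  exists r, forall z t : R, r < z -> 0 < t < S -> M - e <= psi z t.
Proof.
move=> M0 a_gt0 ca psi_ge0 psi_0 psitE psitc dpsi e e0.
have [S0|S0] := leP S 0.
  exists 0 => z t _ /andP[t0 /(lt_trans t0)]; by rewrite ltNge S0.
(* [8 C] bounds the size of [4 a w''] in units of [q], as [w'' = - 2 q]; the extra 1 makes the
   inequality strict. *)
pose C := a 0 + 1; pose K := 8 * C + 1.
have C0 : 0 < C by rewrite addr_gt0// a_gt0.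
have K0 : 0 < K by rewrite /K; lra.
have [eta /= eta0 etaP] : exists2 eta, 0 < eta &
    forall s : R, 0 <= s < eta -> a s <= C.
  have /cvgr_lt/(_ C) := ca; rewrite /C ltrDl => /(_ ltr01)[eta /= eta0 etaP].
  exists eta => // s /andP[]; rewrite le_eqVlt => /predU1P[<- _|s0 s_eta].
    by rewrite lerDl.
  by rewrite ltW// etaP//= sub0r normrN gtr0_norm.
(* The second term keeps the slope of the parabola, at most [2 M / L], below [eta]; the third keeps
   its drop [q K t] at the vertex at most [e]; the first gives [L >= 1]. *)
pose L := 1 + 2 * M / eta + K * M * S / e.
have L1 : 1 <= L.
  have m1 : 0 <= 2 * M / eta by rewrite divr_ge0 ?mulr_ge0// ltW.
  have m2 : 0 <= K * M * S / e by rewrite divr_ge0 ?mulr_ge0// ltW.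
  by rewrite /L; lra.
have L0 : 0 < L by exact: lt_le_trans ltr01 L1.
have Leta : 2 * M < eta * L.
  rewrite [ltRHS]mulrC -ltr_pdivrMr//; apply: (@lt_le_trans _ _ (1 + 2 * M / eta)).
    by rewrite ltrDr.
  by rewrite /L lerDl divr_ge0 ?mulr_ge0// ltW.
have LS : K * M * S <= e * L.
  by rewrite [leRHS]mulrC -ler_pdivrMr// /L lerDr addr_ge0// divr_ge0 ?mulr_ge0// ltW.
(* This [q] makes the parabola at most 0 on [|y - z| = L] at nonnegative times. *)
pose q := M / L ^+ 2.
have q0 : 0 < q by rewrite divr_gt0// exprn_gt0.
have qL : q * L ^+ 2 = M by rewrite divfK// gt_eqF// exprn_gt0.
(* [z > L] keeps the interval [[z - L, z + L]] among positive numbers. *)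
exists L => z t zL tS; have /andP[t_gt0 ltS] := tS.
pose w y s := M - q * ((y - z) ^+ 2 + K * s).
have wzt : M - e <= w z t.
  rewrite /w subrr expr0n add0r lerD2l lerN2.
  rewrite -(ler_pM2r (exprn_gt0 2 L0)) mulrAC qL mulrC.
  have : K * t * M <= K * M * S.
    by rewrite mulrAC ler_pM2l ?mulr_gt0// ltW.
  move/le_trans; apply; apply: (le_trans LS).
  by rewrite expr2 ler_pM2l// ler_peMr// ltW.
apply: (le_trans wzt); rewrite leNgt; apply/negP => psi_lt.
pose D (p : R * R) := psit p - w p.1 p.2.
pose X : set (R * R) := `[z - L, z + L]%classic `*` `[0, t]%classic.
have Xpos p : X p -> 0 < p.1.
  move=> [/= + _]; rewrite in_itv /= => /andP[/(lt_le_trans _)+ _]; apply.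
  by rewrite subr_gt0.
have XS p : X p -> 0 <= p.2 < S.
  by move=> [_ /=]; rewrite in_itv /= => /andP[-> /le_lt_trans]; apply.
have cD : {within X, continuous D}.
  apply: continuous_in_subspaceT => p; rewrite inE => /Xpos p1.
  have cpsi : {for p, continuous psit} by case: p p1 => y s; exact: psitc.
  have cw : w x.1 x.2 @[x --> p] --> w p.1 p.2.
    apply: cvgB; first exact: cvg_cst.
    apply: cvgM; first exact: cvg_cst.
    apply: cvgD; last by apply: cvgM; [exact: cvg_cst | exact: cvg_snd].
    have c1 : x.1 - z @[x --> p] --> p.1 - z.
      by apply: cvgB; [exact: cvg_fst | exact: cvg_cst].
    exact: (cvgM c1 c1).
  exact: (cvgB cpsi cw).
have cX : compact X by apply: compact_setX; exact: segment_compact.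
have Xzt : X (z, t).
  by split; rewrite /= in_itv /=; apply/andP; split; lra.
have [[y1 s1] + Dmin] := compact_EVT_min (ex_intro _ _ Xzt) cX cD.
rewrite inE => X1; have y1_gt0 := Xpos _ X1; have s1S' := XS _ X1.
rewrite /= in y1_gt0 s1S'.
case: (X1) => /=; rewrite !in_itv /= => /andP[y1l y1r] /andP[s1_ge0 s1t].
have DE y s : X (y, s) -> D (y, s) = psi y s - w y s.
  by move=> Xys; rewrite /D -psitE//; [exact: (Xpos _ Xys) | exact: (XS _ Xys)].
have Dneg : psi y1 s1 - w y1 s1 < 0.
  rewrite -DE//; apply: (@le_lt_trans _ _ (D (z, t))); first by apply: Dmin; rewrite inE.
  by rewrite DE// subr_lt0.
(* A negative minimum lies off the parabolic boundary: [w <= M = psi] at time 0, and [w <= 0 <= psi]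
   where [|y - z| = L]. *)
have s1_gt0 : 0 < s1.
  rewrite lt0r s1_ge0 andbT; apply: contraTneq Dneg => ->.
  rewrite psi_0// /w mulr0 addr0 opprB addrC subrK -leNgt mulr_ge0 ?sqr_ge0//.
  exact: ltW.
have s1S : 0 < s1 < S by rewrite s1_gt0; case/andP: s1S'.
have y1L : `|y1 - z| < L.
  have y1L' : `|y1 - z| <= L by rewrite ler_distlC; apply/andP; split; lra.
  rewrite lt_neqAle y1L' andbT; apply: contraTneq Dneg => y1L.
  rewrite -leNgt subr_ge0; apply: le_trans (psi_ge0 _ _ (ltW y1_gt0) s1S).
  rewrite /w -[(y1 - z) ^+ 2]real_normK ?num_real// y1L mulrDr qL.
  rewrite opprD addrA subrr sub0r oppr_le0.
  by apply: mulr_ge0; [exact: ltW | apply: mulr_ge0; exact: ltW].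
have := y1L; rewrite ltr_distl => /andP[y1l' y1r'].
have [dz dzz dt] := dpsi _ _ y1_gt0 s1S.
pose g y := w y s1 - psi y s1.
pose g1 y := - (2 * q * (y - z)) - psi1 y s1.
have dw y : is_derive (y : R) 1 (w^~ s1) (- (2 * q * (y - z))).
  by apply: is_derive_eq; rewrite /GRing.scale /=; ring.
have dg : \forall y \near y1, is_derive (y : R) 1 g (g1 y).
  near=> y; have y_gt0 : 0 < y by near: y; exact: lt_nbhsr.
  have [dy _ _] := dpsi _ _ y_gt0 s1S.
  exact: (is_deriveB (dw y) dy).
have dg1 : is_derive (y1 : R) 1 g1 (- (2 * q) - psi2 y1 s1).
  have dl : is_derive (y1 : R) 1 (fun y => - (2 * q * (y - z))) (- (2 * q)).
    by apply: is_derive_eq; rewrite /GRing.scale /=; ring.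
  exact: (is_deriveB dl dzz).
have gmax : \forall y \near y1, g y <= g y1.
  near=> y; have Xy : X (y, s1).
    split; rewrite /= in_itv /= ?s1_ge0//; apply/andP; split; apply: ltW.
      by near: y; exact: lt_nbhsr.
    by near: y; exact: lt_nbhsl.
  have : D (y1, s1) <= D (y, s1) by apply: Dmin; rewrite inE.
  by rewrite !DE// /g; lra.
(* At the minimum the slopes of [psi] and [w] agree and [psi2 >= - 2 q]. *)
have [/eqP] := second_derivative_test dg dg1 gmax.
rewrite subr_eq0 => /eqP psi1E psi2_ge.
have q2_gt0 : 0 < 2 * q by exact: mulr_gt0.
have aC : a `|psi1 y1 s1| <= C.
  apply: etaP; rewrite normr_ge0 /= -psi1E normrN normrM gtr0_norm//.
  rewrite -(ltr_pM2r L0); apply: le_lt_trans Leta.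
  have -> : 2 * M = 2 * q * (L * L) by rewrite -mulrA -expr2 qL.
  by rewrite -mulrA (ler_pM2l q2_gt0) ler_pM2r// ltW.
have dT : is_derive s1 1 (fun s => w y1 s - psi y1 s)
    (- (q * K) - 4 * a `|psi1 y1 s1| * psi2 y1 s1).
  have dws : is_derive (s1 : R) 1 (w y1) (- (q * K)).
    by apply: is_derive_eq; rewrite /GRing.scale /=; ring.
  exact: (is_deriveB dws dt).
have ge0 : 0 <= - (q * K) - 4 * a `|psi1 y1 s1| * psi2 y1 s1.
  apply: (left_max_derive_ge0 s1_gt0 dT) => s /andP[s_gt0 ss1].
  have Xs : X (y1, s).
    split; rewrite /= in_itv /=; first by rewrite y1l y1r.
    by rewrite ltW// (le_trans ss1 s1t).
  have : D (y1, s1) <= D (y1, s) by apply: Dmin; rewrite inE.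
  by rewrite !DE//; lra.
have : a `|psi1 y1 s1| * - (2 * q) <= a `|psi1 y1 s1| * psi2 y1 s1.
  by rewrite ler_wpM2l//; [exact/ltW/a_gt0 | rewrite -subr_le0].
have : q * a `|psi1 y1 s1| <= q * C by rewrite ler_wpM2l// ltW.
(* Together: [0 <= - q K - 4 a psi2 <= - q K + 8 q C = - q]. *)
move: ge0; rewrite /K; move: (a _) (psi2 _ _) => al p2; nra.
Unshelve. all: by end_near. Qed.

(** * Extensions and rescaling *)

(* Precomposing with clamp T extends a function of t from [0, T] to all of R
   without losing continuity. *)
Definition clamp (R : realType) (T t : R) : R := Num.max 0 (Num.min T t).

Lemma clamp_in (R : realType) (T t : R) : 0 <= T -> 0 <= clamp T t <= T.
Proof. by move=> T0; rewrite /clamp le_max lexx /= ge_max T0 ge_min lexx. Qed.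

Lemma clamp_id (R : realType) (T t : R) : 0 <= t <= T -> clamp T t = t.
Proof. by move=> /andP[t0 tT]; rewrite /clamp (min_r tT) (max_r t0). Qed.

Lemma clamp_continuous (R : realType) (T : R) : continuous (clamp T).
Proof.
move=> t; apply: (@continuous_max _ _ (cst 0) (Num.min T)); first exact: cst_continuous.
by apply: (@continuous_min _ _ (cst T) id); [exact: cst_continuous | exact: cvg_id].
Qed.

Lemma Ck_on_sub (R : realType) (V : normedModType R) (k : nat) (U W : set V)
    (f : V -> R) : W `<=` U -> Ck_on k U f -> Ck_on k W f.
Proof.
move=> WU; elim: k f => [|k IH] f [cf Cf]; split=> //.
- by move=> x /WU; exact: cf.
- by move=> x /WU; exact: cf.
- move=> v; have [df Cdf] := Cf v; split; last exact: IH.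
  by move=> x /WU; exact: df.
Qed.

Lemma derivable_slice (R : realType) (V : normedModType R) (U : set (V * R))
    (g : V * R -> R) (f : V -> R -> R) (x : V) (t : R) :
  (forall k, Ck_on k U g) -> U (x, t) ->
  (\forall s \near t, f x s = g (x, s)) -> derivable (f x) t 1.
Proof.
move=> Cg Uxt fg; apply: (@near_eq_derivable _ _ _ (fun s => g (x, s))).
  by apply: filterS fg => s ->.
apply: (derive_slice_right g x t 1).1.
by case: (Cg 1%N) => _ /(_ (0, 1))[+ _]; exact.
Qed.

(** The smooth [g] is controlled only near the strip, hence the clamped time in [ft]. At interior
    times [f] and [g] agree nearby, which gives the time derivative. *)
Lemma smooth_on_strip (R : realType) (V : normedModType R) (T : R)
    (f : V -> R -> R) : 0 < T ->
  smooth_on ([set: V] `*` `[0, T]) (fun z : V * R => f z.1 z.2) ->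
  exists ft : V * R -> R,
  [/\ continuous ft, forall x t, 0 <= t <= T -> f x t = ft (x, t),
      forall k t, 0 <= t <= T -> Ck_on k setT (f^~ t) &
      forall x t, 0 < t < T -> derivable (f x) t 1].
Proof.
move=> T0 [U [g [oU DU Cg fg]]].
have UT x t : 0 <= t <= T -> U (x, t).
  by move=> tT; apply: DU; split => //=; rewrite in_itv.
have fE x t : 0 <= t <= T -> f x t = g (x, t).
  by move=> tT; apply: (fg (x, t)); split => //=; rewrite in_itv.
exists (fun z => g (z.1, clamp T z.2)); split.
- move=> z.
  have cc : {for z, continuous (fun z : V * R => (z.1, clamp T z.2))}.
    have c2 : clamp T q.2 @[q --> z] --> clamp T z.2.
      exact: (@continuous_comp _ _ _ (fun q : V * R => q.2) (clamp T) z cvg_snd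
        (@clamp_continuous _ T z.2)).
    exact: (cvg_pair cvg_fst c2).
  have cg : {for (z.1, clamp T z.2), continuous g}.
    by case: (Cg 0%N) => + _; apply; apply: UT; apply: clamp_in; exact: ltW.
  exact: (@continuous_comp _ _ _ (fun z : V * R => (z.1, clamp T z.2)) g z cc cg).
- by move=> x t tT; rewrite /= clamp_id// fE.
- move=> k t tT; have -> : f^~ t = (fun x => g (x, t)).
    by apply/funext => x; exact: fE.
  by apply: (Ck_on_sub _ (Ck_on_slice t (Cg k))) => x _; exact: UT.
- move=> x t /andP[t0 tT]; apply: (derivable_slice Cg).
    by apply: UT; rewrite !ltW.
  near=> s; apply: fE; apply/andP; split; apply: ltW.
    by near: s; exact: lt_nbhsr.
  by near: s; exact: lt_nbhsl.
Unshelve. all: by end_near. Qed.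

(** Staying at [z > 0] avoids the excluded corner, and space derivatives are taken on the open
    half-line. *)
Lemma smooth_on_quadrant (R : realType) (T : R) (f : R -> R -> R) : 0 < T ->
  smooth_on [set z : R * R | [/\ 0 <= z.1, 0 <= z.2 <= T & z != (0, 0)]]
    (fun z : R * R => f z.1 z.2) ->
  exists ft : R * R -> R,
  [/\ forall z t : R, 0 < z -> {for (z, t), continuous ft},
      forall z t : R, 0 < z -> 0 <= t <= T -> f z t = ft (z, t),
      forall z t : R, 0 < z -> 0 <= t <= T ->
        derivable (f^~ t) z 1 /\ derivable (f^~ t)^`()%classic z 1 &
      forall z t : R, 0 < z -> 0 < t < T -> derivable (f z) t 1].
Proof.
move=> T0 [U [g [oU DU Cg fg]]].
have D z t : 0 < z -> 0 <= t <= T ->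
    [set z : R * R | [/\ 0 <= z.1, 0 <= z.2 <= T & z != (0, 0)]] (z, t).
  move=> z0 tT; split => //=; first exact: ltW.
  by rewrite xpair_eqE negb_and gt_eqF.
have UT z t : 0 < z -> 0 <= t <= T -> U (z, t) by move=> z0 tT; exact/DU/D.
have fE z t : 0 < z -> 0 <= t <= T -> f z t = g (z, t).
  by move=> z0 tT; exact: (fg (z, t) (D z t z0 tT)).
exists (fun z => g (z.1, clamp T z.2)); split.
- move=> z t z0.
  have cc : {for (z, t), continuous (fun z : R * R => (z.1, clamp T z.2))}.
    have c2 : clamp T q.2 @[q --> (z, t)] --> clamp T t.
      exact: (@continuous_comp _ _ _ (fun q : R * R => q.2) (clamp T) (z, t) cvg_snd
        (@clamp_continuous _ T t)).
    exact: (cvg_pair cvg_fst c2).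
  have cg : {for (z, clamp T t), continuous g}.
    by case: (Cg 0%N) => + _; apply; apply: UT => //; apply: clamp_in; exact: ltW.
  exact: (@continuous_comp _ _ _ (fun z : R * R => (z.1, clamp T z.2)) g (z, t) cc cg).
- by move=> z t z0 tT; rewrite /= clamp_id// fE.
- move=> z t z0 tT.
  have [_ /(_ 1)[df [_ /(_ 1)[ddf _]]]] : Ck_on 2 [set z : R | 0 < z] (f^~ t).
    apply: (@eq_Ck_on _ _ _ _ (fun z => g (z, t))); first exact: open_gt.
      by move=> y y0; rewrite fE.
    by apply: (Ck_on_sub _ (Ck_on_slice t (Cg 2%N))) => y y0; exact: UT.
  split; first exact: df.
  by have -> : (f^~ t)^`()%classic = 'D_1 (f^~ t);
    [apply/funext => y; rewrite derive1E | exact: ddf].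
- move=> z t z0 /andP[t0 tT]; apply: (derivable_slice Cg).
    by apply: UT; rewrite ?ltW.
  near=> s; apply: fE => //; apply/andP; split; apply: ltW.
    by near: s; exact: lt_nbhsr.
  by near: s; exact: lt_nbhsl.
Unshelve. all: by end_near. Qed.

Lemma osc_leP (R : realType) (X : Type) (f : X -> R) (M : R) (x y : X) :
  (osc f <= M%:E)%E -> f y - f x <= M.
Proof.
move=> oM; rewrite -lee_fin EFinB; apply: le_trans oM; apply: leeB.
  by apply: ereal_sup_ubound; exists y.
by apply: ereal_inf_lbound; exists x.
Qed.

(** * Parabolic rescaling of the one-dimensional solution *)

Section rescaling.
Variables (R : realType) (T M : R) (a : R -> R) (phi : R -> R -> R).
Hypotheses (T0 : 0 < T) (M0 : 0 < M).
Hypothesis phiC : smooth_on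
  [set z : R * R | [/\ 0 <= z.1, 0 <= z.2 <= T & z != (0, 0)]]
  (fun z : R * R => phi z.1 z.2).
Hypothesis phiE : forall z t, 0 < z -> 0 < t < T ->
  (phi z)^`()%classic t =
  4 * a `|(phi^~ t)^`()%classic z| * (phi^~ t)^`(2)%classic z.
Hypothesis phi_0 : forall z, 0 < z -> phi z t @[t --> 0^'+] --> (1 : R).

(* The rescaling z -> z / M, t -> t / M^2 preserves the equation. *)
Definition rescaled z t := M * phi (z / M) (t / M ^+ 2).

Let psi1 z t := (phi^~ (t / M ^+ 2))^`()%classic (z / M).
Let psi2 z t := (phi^~ (t / M ^+ 2))^`(2)%classic (z / M) / M.
(** Times below [S] satisfy both [t < T] and [t / M^2 < T], the ranges for [u] and for the rescaled
    [phi]. *)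
Let S := Num.min T (M ^+ 2 * T).

Let M20 : 0 < M ^+ 2. Proof. exact: exprn_gt0. Qed.

Let timeS t : 0 < t < S -> 0 < t / M ^+ 2 < T.
Proof.
rewrite lt_min => /andP[t0 /andP[_ tT]].
by rewrite divr_gt0//= ltr_pdivrMr// mulrC.
Qed.

Lemma rescaled_regular : exists psit : R * R -> R,
  [/\ forall z t : R, 0 < z -> 0 <= t <= S -> rescaled z t = psit (z, t),
      forall z t : R, 0 < z -> {for (z, t), continuous psit} &
      forall z : R, 0 < z -> rescaled z 0 = M].
Proof.
have [ft [ftc ftE _ _]] := smooth_on_quadrant T0 phiC.
exists (fun z => M * ft (z.1 / M, z.2 / M ^+ 2)); split.
- move=> z t z0; rewrite le_min => /andP[t0 /andP[_ tT]].
  rewrite /rescaled ftE ?divr_gt0// divr_ge0 ?(ltW M20)//=.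
  by rewrite ler_pdivrMr// mulrC.
- move=> z t z0.
  have c1 : q.1 / M @[q --> (z, t)] --> z / M.
    by apply: cvgM; [exact: cvg_fst | exact: cvg_cst].
  have c2 : q.2 / M ^+ 2 @[q --> (z, t)] --> t / M ^+ 2.
    by apply: cvgM; [exact: cvg_snd | exact: cvg_cst].
  have c3 := @continuous_comp _ _ _ (fun q : R * R => (q.1 / M, q.2 / M ^+ 2)) ft
    (z, t) (cvg_pair c1 c2) (ftc _ _ (divr_gt0 z0 M0)).
  have c4 : ft (q.1 / M, q.2 / M ^+ 2) @[q --> (z, t)] --> ft (z / M, t / M ^+ 2).
    exact: c3.
  by apply: cvgM; [exact: cvg_cst | exact: c4].
- move=> z z0; have zM0 := divr_gt0 z0 M0.
  rewrite /rescaled mul0r ftE ?lexx ?ltW//.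
  (* [ft] is continuous at [(z / M, 0)] and agrees with [phi] at small positive times, so its value
     there is the prescribed limit 1. *)
  suff -> : ft (z / M, 0) = 1 by rewrite mulr1.
  have c1 : ft (z / M, t) @[t --> 0^'+] --> ft (z / M, 0).
    apply: cvg_at_right_filter.
    have cp : {for (0 : R), continuous (fun t : R => (z / M, t))}.
      exact: (cvg_pair (cvg_cst (z / M)) cvg_id).
    exact: (@continuous_comp _ _ _ (fun t : R => (z / M, t)) ft 0 cp (ftc _ _ zM0)).
  have c2 : ft (z / M, t) @[t --> 0^'+] --> (1 : R).
    apply: (cvg_trans _ (phi_0 zM0)); apply: near_eq_cvg; near=> t.
    have tT : t < T by near: t; exact: nbhs_right_lt.
    by rewrite ftE// !ltW.
  exact: (cvg_unique _ c1 c2).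
Unshelve. all: by end_near. Qed.

(** The prefactor [M] cancels the factor [1 / M] of the first space derivative, so [a] sees the same
    slope; both sides of the equation acquire the factor [1 / M]. *)
Lemma is_derive_rescaled (z t : R) : 0 < z -> 0 < t < S ->
  [/\ is_derive z 1 (rescaled^~ t) (psi1 z t),
      is_derive z 1 (psi1^~ t) (psi2 z t) &
      is_derive t 1 (rescaled z) (4 * a `|psi1 z t| * psi2 z t)].
Proof.
move=> z0 tS; have tT := timeS tS; have zM0 := divr_gt0 z0 M0.
have [ft [_ _ /(_ _ _ zM0) dz /(_ _ _ zM0 tT) dt]] := smooth_on_quadrant T0 phiC.
have [|{}dz ddz] := dz (t / M ^+ 2); first by case/andP: tT => /ltW -> /ltW.
have M_neq0 : M != 0 by rewrite gt_eqF.
have dl (c : R) (s : R) : is_derive s 1 (fun s : R => s / c) c^-1.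
  by apply: is_derive_eq; rewrite /GRing.scale /=; ring.
have d1 : is_derive (z / M) 1 (phi^~ (t / M ^+ 2)) (psi1 z t).
  by rewrite /psi1 derive1E; exact: derivableP.
have d2 : is_derive (z / M) 1 (phi^~ (t / M ^+ 2))^`()%classic
    ((phi^~ (t / M ^+ 2))^`(2)%classic (z / M)).
  by rewrite derive1nS derive1n1 derive1E; exact: derivableP.
have d3 : is_derive (t / M ^+ 2) 1 (phi (z / M))
    (4 * a `|psi1 z t| * (phi^~ (t / M ^+ 2))^`(2)%classic (z / M)).
  by rewrite /psi1 -phiE// derive1E; exact: derivableP.
split.
- have := is_deriveZ M (@is_derive1_comp _ _ (fun s => s / M) z _ _ d1 (dl M z)).
  have -> : M *: (psi1 z t / M) = psi1 z t by rewrite /GRing.scale /=; field.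
  by [].
- exact: (@is_derive1_comp _ _ (fun s => s / M) z _ _ d2 (dl M z)).
- have := is_deriveZ M
    (@is_derive1_comp _ _ (fun s => s / M ^+ 2) t _ _ d3 (dl (M ^+ 2) t)).
  have -> : M *: (4 * a `|psi1 z t| * (phi^~ (t / M ^+ 2))^`(2)%classic (z / M)
      / M ^+ 2) = 4 * a `|psi1 z t| * psi2 z t.
    by rewrite /psi2 /GRing.scale /=; field.
  by [].
Qed.

End rescaling.

Theorem theorem5p1 (R : realType) (n : nat) (T M : R)
  (A : 'rV[R]_n -> R -> 'M[R]_n) (b : 'rV[R]_n -> R -> R)
  (G : set 'rV[R]_n) (u : 'rV[R]_n -> R -> R) (u0 : 'rV[R]_n -> R)
  (alphat : R -> R) (phi : R -> R -> R) :
  (0 < n)%N -> 0 < T -> 0 < M ->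
  (* the coefficients *)
  (forall p t, 0 <= t <= T -> (A p t)^T = A p t /\ psd (A p t)) ->
  (forall i j, smooth_on ([set: 'rV[R]_n] `*` `[0, T])
                 (fun z : 'rV[R]_n * R => A z.1 z.2 i j)) ->
  (* the solution u *)
  smooth_on ([set: 'rV[R]_n] `*` `[0, T])
    (fun z : 'rV[R]_n * R => u z.1 z.2) ->
  (forall x t, 0 < t < T ->
     (u x)^`()%classic t =
     \sum_(i < n) \sum_(j < n)
        A (gradient (u^~ t) x) t i j * partial i (partial j (u^~ t)) x
     + b (gradient (u^~ t) x) t) ->
  (forall x, u x 0 = u0 x) ->
  smooth_on [set: 'rV[R]_n] u0 ->
  (osc u0 <= M%:E)%E ->
  is_lattice G ->
  (forall x g t, G g -> 0 <= t <= T -> u (x + g) t = u x t) ->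
  (forall x g, G g -> u0 (x + g) = u0 x) ->
  (* alpha(p, t) = alphat(|p|) > 0 *)
  (forall p t, p != 0 -> 0 <= t <= T ->
     alpha (A p t) p = alphat (enorm p)) ->
  (forall s, 0 <= s -> 0 < alphat s) ->
  alphat s @[s --> 0^'+] --> alphat 0 ->
  (* the solution phi; the limit conditions preclude smoothness at (0, 0) *)
  smooth_on [set z : R * R | [/\ 0 <= z.1, 0 <= z.2 <= T & z != (0, 0)]]
    (fun z : R * R => phi z.1 z.2) ->
  (forall z t, 0 < z -> 0 < t < T ->
     (phi z)^`()%classic t =
     4 * alphat `|(phi^~ t)^`()%classic z| * (phi^~ t)^`(2)%classic z) ->
  (forall z, 0 < z -> phi z t @[t --> 0^'+] --> (1 : R)) ->
  (forall t, 0 < t <= T -> phi 0 t = 0) ->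
  (forall t, 0 < t <= T -> phi z t @[z --> +oo] --> (1 : R)) ->
  (* no loss: on these arguments the conclusion itself forces phi >= 0 *)
  (forall z t, 0 <= z -> 0 < t <= T -> M ^+ 2 * t <= T -> 0 <= phi z t) ->
  forall (x y : 'rV[R]_n) (t : R), 0 < t <= T -> t / M ^+ 2 <= T ->
    `|u y t - u x t| <= M * phi (enorm (y - x) / M) (t / M ^+ 2).
Proof.
move=> _ T0 M0 psdA AC uC pde u_0 _ oscM latG uG _ alphaE a_gt0 ca phiC phiE
  phi_0 _ _ phi_ge0.
have [ut [utc utE uCk uD]] := smooth_on_strip T0 uC.
have [psit [psitE psitc psi_0]] := rescaled_regular T0 M0 phiC phi_0.
have dpsi := is_derive_rescaled T0 M0 phiC phiE.
pose S := Num.min T (M ^+ 2 * T).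
have M20 : 0 < M ^+ 2 by exact: exprn_gt0.
have ST : S <= T by rewrite /S ge_min lexx.
have T00 : 0 <= (0 : R) <= T by rewrite lexx ltW.
have osc0 x y : u y 0 - u x 0 <= M by rewrite !u_0; exact: osc_leP.
have psi_ge0 (z t : R) : 0 <= z -> 0 < t <= S -> 0 <= rescaled M phi z t.
  rewrite le_min => z0 /andP[t0 /andP[tT tMT]]; rewrite mulr_ge0 ?(ltW M0)//.
  apply: phi_ge0; first by rewrite divr_ge0// ltW.
    by rewrite divr_gt0//= ler_pdivrMr// mulrC.
  by rewrite mulrC divfK// gt_eqF.
have psi_ge0' (z t : R) : 0 <= z -> 0 < t < S -> 0 <= rescaled M phi z t.
  by move=> z0 /andP[t0 tS]; rewrite psi_ge0// t0 ltW.
have psitE' (z t : R) : 0 < z -> 0 <= t < S -> rescaled M phi z t = psit (z, t).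
  by move=> z0 /andP[t0 tS]; rewrite psitE// t0 ltW.
have ell (t s : R) (e v : 'rV[R]_n) : 0 < t < S -> enorm e = 1 ->
    alphat `|s| * dot v e ^+ 2 <= dot (v *m A (s *: e) t) v.
  move=> /andP[t_gt0 tS] e1.
  have tT : 0 <= t <= T by rewrite ltW//= ltW// (lt_le_trans tS).
  apply: (@elliptic_lower_bound _ _ (A^~ t)) => //.
  - by move=> p; case: (psdA p t tT).
  - by move=> p p0; exact: alphaE.
  - move=> i j.
    have [_ [_ _ /(_ 0%N t tT)[+ _] _]] :=
      @smooth_on_strip _ _ _ (fun p t => A p t i j) T0 (AC i j).
    exact.
have far := half_line_lower_bound M0 a_gt0 ca psi_ge0' psi_0 psitE' psitc dpsi.
have main := doubling psdA (uCk 2%N) uD utc utE pde latG uG osc0 ST a_gt0 ell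
  psi_ge0' psi_0 far psitE' psitc dpsi.
move=> x y t /andP[t0 tT] tMT.
have tS : 0 < t <= S by rewrite t0 le_min tT /= mulrC -ler_pdivrMr.
(* [main] covers [t < S]; letting [s] increase to [t] in the continuous extensions [ut] and [psit]
   includes [t = S]. *)
have one_sided (p d : 'rV[R]_n) : u (p + d) t - u p t <= rescaled M phi (enorm d) t.
  have [->|d0] := eqVneq d 0; first by rewrite addr0 subrr psi_ge0// enorm_ge0.
  have z0 : 0 < enorm d by rewrite enorm_gt0.
  have slice (q : 'rV[R]_n) : ut (q, s) @[s --> t^'-] --> ut (q, t).
    apply: cvg_at_left_filter.
    exact: (@continuous_comp _ _ _ (fun s : R => (q, s)) ut t
      (cvg_pair (cvg_cst q) cvg_id) (@utc _)).
  have slicep : psit (enorm d, s) @[s --> t^'-] --> psit (enorm d, t).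
    apply: cvg_at_left_filter.
    exact: (@continuous_comp _ _ _ (fun s : R => (enorm d, s)) psit t
      (cvg_pair (cvg_cst (enorm d)) cvg_id) (psitc _ _ z0)).
  have t_ge0 : 0 <= t by exact: ltW.
  rewrite psitE ?utE ?t_ge0//; last by case/andP: tS.
  apply: (@ler_cvg_to _ t^'- _ _ _ _ _ _ (cvgB (slice (p + d)) (slice p)) slicep).
  near=> s.
  have s0 : 0 < s by near: s; exact: nbhs_left_gt.
  have st : s < t by [].
  have sS : 0 < s < S by rewrite s0 (lt_le_trans st)//; case/andP: tS.
  have sT : 0 <= s <= T by rewrite !ltW// (lt_le_trans st).
  have sS' : 0 <= s < S by case/andP: sS => /ltW -> ->.
  by have := main p d s sS; rewrite !utE// psitE'.
(* The lower bound is the one-sided estimate with [x] and [y] exchanged. *)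
rewrite -[leRHS]/(rescaled M phi (enorm (y - x)) t) ler_norml; apply/andP; split.
  rewrite lerNl opprB -enormN opprB.
  by have := one_sided y (x - y); rewrite (addrC y) subrK.
by have := one_sided x (y - x); rewrite (addrC x) subrK.
Unshelve. all: by end_near. Qed.
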